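(* Let $\mathfrak a$ be a fractional ideal of $K$, $m\in\mathbb N$, let $(\alpha,\beta)$ be a totally positive basis of $\mathfrak a^{-1}$, and let $n\in\mathbb N$ with $$\frac{n}{1-\varepsilon_0^2}\in\mathcal O_K.$$ Then $\Psi(\mathfrak a,m,z)^n$ is invariant under (translation by) $\mathfrak a^{-1}$ and possesses a holomorphic extension to $u=0$ and $v=0$ in local coordinates $(u,v)$ with respect to $(\alpha,\beta)$. At $u=0$ ($v=0$, respectively) the product vanishes. Its order of vanishing along $u$ ($v$, respectively) is given by $n\operatorname{tr}(\rho(\mathfrak a,m,\alpha)\alpha)$ ($n\operatorname{tr}(\rho(\mathfrak a,m,\beta)\beta)$, respectively).
   Context: $K\subset\mathbb R$ is a real quadratic field of discriminant $D$ ($\sqrt D>0$), $\mathcal O_K$ its ring of integers, $x\mapsto x'$ conjugation, $N(x)=xx'$, $\operatorname{tr}(x)=x+x'$, $\mathfrak d=\sqrt D\,\mathcal O_K$, $\varepsilon_0>1$ the fundamental unit ($\mathcal O_K^\times=\{\pm\varepsilon_0^k:k\in\mathbb Z\}$); ideals are nonzero fractional ideals, $N(\mathfrak a)>0$ the ideal norm. $e(w)=e^{2\pi iw}$, $\mathbb H$ is the upper half plane, $z=(z_1,z_2)\in\mathbb H^2$; $\mu\in\mathfrak a^{-1}$ acts by $z\mapsto(z_1+\mu,z_2+\mu')$. For $w=(w_1,w_2)\in\mathbb R^2$ and $\lambda\in K$, $\operatorname{tr}(\lambda w)=\lambda w_1+\lambda'w_2$. $\Lambda^+(\mathfrak a,m)=\{\lambda\in\mathfrak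 a\mathfrak d^{-1}:N(\lambda)=-mN(\mathfrak a)/D,\ \lambda>0\}$. Let $\sigma:\Lambda^+(\mathfrak a,m)\to\{\pm1\}$ satisfy $\sigma(\lambda)=1$ for all $\lambda$ sufficiently close to $0$ and $\sigma(\lambda)=-1$ for all sufficiently large $\lambda$. The local Borcherds product is $\Psi(\mathfrak a,m,z)=\Psi_\sigma(\mathfrak a,m,z)=\prod_{\lambda\in\Lambda^+(\mathfrak a,m)}\sigma(\lambda)\bigl(e(|\lambda|z_1)-e(|\lambda'|z_2)\bigr)$; it converges, and changing $\sigma$ changes it only by a sign. Local coordinates $(u,v)\in\mathbb C^2$ with respect to $(\alpha,\beta)$: $2\pi iz_1=\alpha\log u+\beta\log v$, $2\pi iz_2=\alpha'\log u+\beta'\log v$; $\mathfrak a^{-1}$-invariant functions on $\mathbb H^2$ can be expressed as functions of $(u,v)$. For $w\in(\mathbb R_{>0})^2$, $R(\mathfrak a,m,w)$ is the (finite) set of $\lambda\in\Lambda^+(\mathfrak a,m)$ which are minimal with $\operatorname{tr}(\lambda w)\ge0$ in their orbit under multiplication by $(\mathcal O_K^\times)^2$. The Weyl vector is $\rho(\mathfrak a,m,w)=\sum_{\lambda\in R(\mathfrak a,m,w)}\frac{\lambda}{\varepsilon_0^2-1}$; for totally positive $\alpha\in K$, $\rho(\mathfrak a,m,\alpha)=\rho(\mathfrak a,m,(\alpha,\alpha'))$.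
   Formalization: The vanishing at u=0 and v=0 is stated only when Λ⁺(𝔞,m) is nonempty: if it is empty (e.g. D=5, 𝔞=O_K, m=2, n=1) then Ψ=1 and does not vanish. The invariance, the holomorphic extension and the order formulas are stated without this condition. *)

(* Defs.v *)
From HB Require Import structures.
From mathcomp Require Import all_boot all_order all_algebra all_field.
From mathcomp Require Import all_classical all_reals all_analysis.
From mathcomp.analysis Require Import showcase.summability.
From mathcomp Require Import finmap complex.

Set Implicit Arguments.
Unset Strict Implicit.
Unset Printing Implicit Defensive.

Import Order.TTheory GRing.Theory Num.Theory.
Import numFieldNormedType.Exports.

Local Open Scope classical_set_scope.
Local Open Scope ring_scope.
Local Open Scope complex_scope.

Section NumberField.
Variable K : fieldExtType rat.

Definition ringInt : set K := [set x | integralOver (intr : int -> K) x].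

Definition unitInt : set K :=
  [set x | [/\ x != 0, ringInt x & ringInt x^-1]].

Definition frac_ideal (a : set K) : Prop :=
  [/\ forall x y, a x -> a y -> a (x - y),
      forall r x, ringInt r -> a x -> a (r * x),
      exists2 x, a x & x != 0 &
      exists d, [/\ ringInt d, d != 0 & forall x, a x -> ringInt (d * x)]].

Definition ideal_mul (a b : set K) : set K :=
  [set x | exists s : seq (K * K),
     (forall p, p \in s -> a p.1 /\ b p.2) /\ x = \sum_(p <- s) p.1 * p.2].

Definition ideal_inv (a : set K) : set K :=
  [set x | forall y, a y -> ringInt (x * y)].

(* The number of cosets x + B with x in A (0 if there are infinitely many). *)
Definition card_quot (A B : set K) : nat :=
  let cosets := [set [set x + y | y in B] | x in A] in
  #|` fset_set cosets|%fset.

(* The generalized index [O : a] = [O : O `&` a] / [a : O `&` a] of lattices;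
   for an integral ideal a it is the index of a in O. *)
Definition ideal_norm (a : set K) : rat :=
  (card_quot ringInt (ringInt `&` a))%:R / (card_quot a (ringInt `&` a))%:R.

Definition zbasis (L : set K) (x y : K) : Prop :=
  [/\ L x, L y &
      forall z, L z <-> exists! c : int * int, z = x *~ c.1 + y *~ c.2].

End NumberField.

(* A real quadratic field inside R. All the data after [rqf_dim] are determined
   by the embedding [emb]: [qconj] is the nontrivial automorphism, [disc] the
   discriminant, [sqrtD] its positive square root, and [eps0] the fundamental
   unit > 1. *)
Record realQuadField (R : realType) := RealQuadField {
  rqf_field :> fieldExtType rat;
  rqf_dim : \dim {: rqf_field}%VS = 2%N;
  emb : {rmorphism rqf_field -> R};
  qconj : {rmorphism rqf_field -> rqf_field};
  qconj_neq_id : exists x, qconj x != x;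
  disc : int;
  discP : exists x y, zbasis (@ringInt rqf_field) x y /\
            (x * qconj y - qconj x * y) ^+ 2 = disc%:~R;
  sqrtD : rqf_field;
  sqrtD_sqr : sqrtD ^+ 2 = disc%:~R;
  sqrtD_gt0 : 0 < emb sqrtD;
  eps0 : rqf_field;
  eps0_gt1 : 1 < emb eps0;
  unitIntP : forall x, unitInt x <->
    exists k : int, x = eps0 ^ k \/ x = - (eps0 ^ k) }.

Arguments emb {R r}.
Arguments qconj {R r}.
Arguments disc {R} r.
Arguments sqrtD {R r}.
Arguments eps0 {R r}.

(* R[i] at the structure which carries the library's canonical topology and
   norm of a field. *)
Definition Cplx (R : realType) : numClosedFieldType := R[i].

Section ComplexAnalysis.
Variable R : realType.
Local Notation C := (Cplx R).

Definition toC (x : R) : C := x%:C.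

Definition cexp (w : C) : C :=
  (expR (complex.Re w) * cos (complex.Im w))
  +i* (expR (complex.Re w) * sin (complex.Im w)).

Definition twopii : C := 0 +i* (2 * pi).

Definition e2pi (w : C) : C := cexp (twopii * w).

Definition upper2 : set (C * C) :=
  [set z | 0 < complex.Im z.1 /\ 0 < complex.Im z.2].

(* [differentiable] is Frechet differentiability over the scalars C;
   this is meant for open U. *)
Definition holomorphic_on (U : set (C * C)) (f : C * C -> C) :
  Prop := forall p, U p -> differentiable f p.

(* For a coordinate function x (one of the two projections), f has order k
   along the divisor x = 0 of U: f = x ^ k g with g holomorphic and not
   identically zero on that divisor. *)
Definition vanishing_order (U : set (C * C)) (x : C * C -> C)
    (f : C * C -> C) (k : nat) : Prop :=
  exists g, [/\ holomorphic_on U g,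
                forall p, U p -> f p = x p ^+ k * g p &
                exists p, [/\ U p, x p = 0 & g p != 0]].

End ComplexAnalysis.

Section LocalBorcherds.
Variables (R : realType) (K : realQuadField R).
Local Notation C := (Cplx R).

Definition qnorm (x : K) : K := x * qconj x.
Definition qtrace (x : K) : K := x + qconj x.

Definition totally_positive (x : K) : Prop := 0 < emb x /\ 0 < emb (qconj x).

Definition different : set K := [set sqrtD * x | x in @ringInt K].

Definition trw (l : K) (w : R * R) : R := emb l * w.1 + emb (qconj l) * w.2.

Definition Lambda_plus (a : set K) (m : nat) : set K :=
  [set l | [/\ ideal_mul a (ideal_inv different) l,
               qnorm l = - (m%:R * ratr (ideal_norm a) / (disc K)%:~R) &
               0 < emb l]].

Definition admissible_sign (a : set K) (m : nat) (sigma : K -> int) : Prop :=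
  [/\ forall l, Lambda_plus a m l -> sigma l = 1 \/ sigma l = -1,
      exists2 d : R, 0 < d &
        forall l, Lambda_plus a m l -> emb l < d -> sigma l = 1 &
      exists M : R,
        forall l, Lambda_plus a m l -> M < emb l -> sigma l = -1].

Definition Psi_factor (sigma : K -> int) (l : K) (z : C * C) : C :=
  (sigma l)%:~R *
    (e2pi (toC `|emb l| * z.1) - e2pi (toC `|emb (qconj l)| * z.2)).

(* The unordered infinite product: the limit of the finite partial products
   along the directed set of finite subsets. *)
Definition Psi (sigma : K -> int) (a : set K) (m : nat) (z : C * C) :
    C :=
  lim ((fun A : {fset K} =>
          \prod_(l <- A | l \in Lambda_plus a m) Psi_factor sigma l z)
         @ totally).

Definition Rset (a : set K) (m : nat) (w : R * R) : set K :=
  [set l | [/\ Lambda_plus a m l, 0 <= trw l w &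
     forall eta, unitInt eta -> 0 <= trw (eta ^+ 2 * l) w ->
       emb l <= emb (eta ^+ 2 * l)]].

Definition weyl (a : set K) (m : nat) (w : R * R) : K :=
  \sum_(l \in Rset a m w) (l / (eps0 ^+ 2 - 1)).

Definition weylK (a : set K) (m : nat) (al : K) : K :=
  weyl a m (emb al, emb (qconj al)).

Definition translate (mu : K) (z : C * C) : C * C :=
  (z.1 + toC (emb mu), z.2 + toC (emb (qconj mu))).

(* p = (u, v) is a pair of local coordinates of z with respect to (al, be);
   s and t are the branches of log u and log v. *)
Definition local_coords (al be : K) (z p : C * C) : Prop :=
  exists s t : C,
    [/\ p = (cexp s, cexp t),
        twopii R * z.1 = toC (emb al) * s + toC (emb be) * t &
        twopii R * z.2 = toC (emb (qconj al)) * s + toC (emb (qconj be)) * t].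

(* The open set of (u, v) which are coordinates of points of H^2, together with
   the two axes. *)
Definition local_chart (al be : K) : set (C * C) :=
  [set p | [\/ p.1 = 0, p.2 = 0 |
              exists2 z, upper2 z & local_coords al be z p]].

End LocalBorcherds.

(* Main.v *)
Require Import Defs.
From HB Require Import structures.
From mathcomp Require Import all_boot all_order all_algebra all_field.
From mathcomp Require Import all_classical all_reals all_analysis.
From mathcomp.analysis Require Import showcase.summability.
From mathcomp Require Import finmap complex ring lra zify.

Import Order.TTheory GRing.Theory Num.Theory numFieldNormedType.Exports.

Local Open Scope classical_set_scope.
Local Open Scope ring_scope.

Set Implicit Arguments.
Unset Strict Implicit.
Unset Printing Implicit Defensive.

(** Write [x > 0 > y] for the two real embeddings of an element [l] of
    [Lambda_plus a m].  Its factor is [+-(e(x z1) - e(-y z2))], and in the local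
    coordinates [e(x z1) / e(-y z2) = u ^ A * v ^ B], where [A = tr(l alpha)] and
    [B = tr(l beta)] are integers because [l alpha] and [l beta] lie in the
    inverse different ([trace_int]).  Taking the smaller power of [u] and of [v]
    out of the two terms, the factor becomes
    [u ^ min(x alpha, -y alpha') * v ^ min(x beta, -y beta')] (real exponents,
    through the logarithms of [u] and [v]) times the polynomial
    [+-(u ^ A+ * v ^ B+ - u ^ A- * v ^ B-)], called [red_factor]
    ([Psi_factor_coords]).

    Multiplication by the squares of the units splits [Lambda_plus a m] into
    finitely many orbits on which [x] runs through a geometric progression, and
    [Rset] is a system of representatives: the elements where the increasing
    sequence of traces becomes nonnegative ([RsetE], [Rset_cover],
    [Rset_finite]).  Before the representative the minimum above is [x alpha],
    from it on it is [-y alpha']; both parts of an orbit are geometric series,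
    and their sum is the trace that occurs in the Weyl vector
    ([sum_common_exponent_box], [common_exponent_sum]).  Hence [Psi] equals
    [u ^ tr(rho(alpha) alpha) * v ^ tr(rho(beta) beta)] times the product of the
    [red_factor]s ([Psi_coords]).  The [n]-fold multiples of the two exponents
    are natural numbers because [n / (1 - eps0 ^ 2)] is integral and both parts
    of each series are positive ([weyl_order]).

    The polynomials [red_factor l] tend to [1] so fast, along every orbit and in
    both directions, that their product converges on the Reinhardt domain
    [conv_dom], which contains the chart ([chart_conv_dom],
    [dev_bound_weight], [red_product_cvg]).  The limit is differentiable because
    the finite products have Taylor expansions of first order with uniformly
    quadratic remainders, bounds of this kind being multiplicative ([jetM]), and
    such expansions pass to pointwise limits ([jet_limit_differentiable]).
    On the axes all but finitely many [red_factor]s equal [1], and none of them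
    vanishes at coordinate [1 / 2] ([red_product_axis_neq0]), so the powers of
    [u] and [v] in front give the exact orders of vanishing.

    Finally, translation of [z] by an element of the inverse of [a] adds integral
    multiples of [2 pi i] to [log u] and [log v]; it does not move [(u, v)]
    ([coords_translate]), and the invariance of the [n]-th power follows from
    its expression in [(u, v)]. *)

(** * Arithmetic of the quadratic field *)

Section RingInt.
Variable K : fieldExtType rat.
Implicit Types x y : K.

Lemma ringInt1 : ringInt (1 : K).
Proof. exact: (integral1 (intr : {rmorphism int -> K})). Qed.

Lemma ringIntD x y : ringInt x -> ringInt y -> ringInt (x + y).
Proof. exact: (@integral_add _ _ (intr : {rmorphism int -> K})). Qed.

Lemma ringIntM x y : ringInt x -> ringInt y -> ringInt (x * y).
Proof. exact: (@integral_mul _ _ (intr : {rmorphism int -> K})). Qed.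

Lemma ringInt0 : ringInt (0 : K).
Proof. exact: (mxpoly.integral0 (intr : {rmorphism int -> K})). Qed.

Lemma ringInt_rmorph (f : {rmorphism K -> K}) x : ringInt x -> ringInt (f x).
Proof.
move=> /(integral_rmorph f); rewrite /ringInt/=.
suff -> : f \o intr = (intr : int -> K) by [].
by apply/funext => z /=; rewrite rmorph_int.
Qed.

Lemma ringInt_sum (I : eqType) (s : seq I) (F : I -> K) :
  (forall i, i \in s -> ringInt (F i)) -> ringInt (\sum_(i <- s) F i).
Proof.
move=> sF; rewrite big_seq; apply: (big_ind (fun x : K => ringInt x)) => //.
- exact: ringInt0.
- exact: ringIntD.
Qed.

End RingInt.

Section QuadField.
Variables (R : realType) (K : realQuadField R).
Implicit Types x y l mu : K.

Lemma emb_eq0 x : (emb x == 0) = (x == 0).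
Proof. exact: fmorph_eq0. Qed.

Lemma qconj_eq0 x : (qconj x == 0) = (x == 0).
Proof. exact: fmorph_eq0. Qed.

Lemma ratr_qconj q : qconj (ratr q : K) = ratr q.
Proof. exact: fmorph_rat. Qed.

Lemma qconj_lin a b x : qconj (ratr a + ratr b * x) = ratr a + ratr b * qconj x.
Proof. by rewrite rmorphD [X in _ + X]rmorphM !ratr_qconj. Qed.

Lemma quad_decomp x y : (forall q, x != ratr q) ->
  exists a b, y = ratr a + ratr b * x.
Proof.
move=> xq.
have freeX : free [:: x; 1].
  rewrite free_cons seq1_free oner_eq0 andbT span_seq1.
  by apply/negP => /vlineP[q xE]; move: (xq q); rewrite xE alg_num_field eqxx.
have bX : basis_of fullv [:: x; 1].
  by rewrite basisEfree freeX subvf rqf_dim.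
have := memvf y; rewrite -(span_basis bX) => /coord_span.
rewrite !big_ord_recl big_ord0 /= addr0 => ->.
exists (coord [tuple x; 1] (lift ord0 ord0) y), (coord [tuple x; 1] ord0 y).
by rewrite addrC -alg_num_field -(rmorphZ_num idfun).
Qed.

Lemma qconj_fixed x : qconj x = x -> exists q, x = ratr q.
Proof.
move=> cx; apply: contrapT => /forallNP xq.
have [y /eqP] := qconj_neq_id K; apply.
have [a [b ->]] := @quad_decomp x y (fun q => introN eqP (xq q)).
by rewrite qconj_lin cx.
Qed.

(** [qconj] sends [x] to a root of the quadratic equation of [x] other than
    [x] itself, that is to the other root; being a root too, [x] is recovered
    from its conjugate in the same way. *)
Lemma qconjK : involutive (@qconj R K).
Proof.
move=> y; have [x cx] := qconj_neq_id K.
have xq q : x != ratr q by apply: contraNneq cx => ->; rewrite ratr_qconj.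
have [q [p x2]] := quad_decomp (x ^+ 2) xq.
have cx2 : qconj x ^+ 2 = ratr q + ratr p * qconj x.
  by rewrite -rmorphXn x2 qconj_lin.
have cxE : qconj x = ratr p - x.
  apply: (@mulfI _ (qconj x - x)); first by rewrite subr_eq0.
  apply/eqP; rewrite -subr_eq0; set c := qconj x.
  have -> : (c - x) * c - (c - x) * (ratr p - x) =
    (c ^+ 2 - (ratr q + ratr p * c)) - (x ^+ 2 - (ratr q + ratr p * x)) by ring.
  by rewrite cx2 x2 !subrr.
have [a [b ->]] := quad_decomp y xq.
by rewrite !qconj_lin cxE rmorphB ratr_qconj cxE subKr.
Qed.

Lemma sqrtD_neq0 : sqrtD != 0 :> K.
Proof. by rewrite -emb_eq0 gt_eqF ?sqrtD_gt0. Qed.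

(** Multiplication by [ratr q] maps the lattice of integral elements into itself.
    The first vector of an integral basis is an eigenvector, so that its integral
    coordinate is [q]: the two basis vectors are independent over the rationals
    because the discriminant is not zero. *)
Lemma ringInt_rat (q : rat) : ringInt (ratr q : K) -> exists z : int, q = z%:~R.
Proof.
move=> Oq; have [x [y [[Ox Oy Oxy] dxy]]] := discP K.
have := (Oxy (ratr q * x)).1 (ringIntM Oq Ox).
move=> [[a b] [/= qE _]]; exists a; apply: (fmorph_inj (GRing.in_alg K)).
rewrite rmorph_int /= alg_num_field; apply/eqP; rewrite -subr_eq0.
set t := _ - _; apply/negP => /negP t0.
suff : sqrtD ^+ 2 = 0 :> K.
  by move/eqP; rewrite sqrf_eq0 (negPf sqrtD_neq0).
rewrite sqrtD_sqr -dxy.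
suff -> : x * qconj y = qconj x * y by rewrite subrr expr0n.
have txy : t * x = b%:~R * y.
  by rewrite mulrBl qE -[x *~ a]mulrzl -[y *~ b]mulrzl addrC addKr.
have ct : @qconj R K t = t by rewrite rmorphB ratr_qconj rmorph_int.
have ctxy : t * qconj x = b%:~R * qconj y.
  by rewrite -{1}ct -rmorphM txy rmorphM rmorph_int.
by apply: (mulfI t0); rewrite mulrA txy mulrA ctxy -!mulrA [qconj y * y]mulrC.
Qed.

Lemma ringInt_qconj x : ringInt x -> ringInt (qconj x).
Proof. exact: ringInt_rmorph. Qed.

(** The norms of [eps0] and of its inverse are rational and integral, hence
    integers, and their product is [1]. *)
Lemma qconj_unit_eps0 : @qconj R K eps0 * eps0 = 1 \/ @qconj R K eps0 * eps0 = - 1.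
Proof.
have unitN x : unitInt x -> exists z : int, qconj x * x = z%:~R.
  move=> [x0 Ox _].
  have [|q qE] := @qconj_fixed (qconj x * x).
    by rewrite rmorphM qconjK mulrC.
  have [|z zE] := @ringInt_rat q; last by exists z; rewrite qE zE ratr_int.
  by rewrite -qE; apply: ringIntM => //; exact: ringInt_qconj.
have ueps : unitInt (eps0 : K).
  by apply/unitIntP; exists 1; left; rewrite expr1z.
have [z zE] := unitN _ ueps.
have [w wE] : exists w : int, @qconj R K (eps0^-1) * eps0^-1 = w%:~R.
  by apply: unitN; case: ueps => ? ? ?; split; rewrite ?invr_eq0 ?invrK.
have eps0_neq0 : (eps0 : K) != 0 by case: ueps.
have : z * w = 1.
  apply: (@intr_inj R); rewrite intrM.
  have embz (t : int) : @emb R K t%:~R = t%:~R by rewrite rmorph_int.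
  rewrite -!embz -zE -wE -rmorphM.
  by rewrite fmorphV mulrACA mulfV ?mulfV ?qconj_eq0 // mulr1 rmorph1.
rewrite zE => zw; have : z \is a GRing.unit by apply/unitrP; exists w; rewrite mulrC zw.
by rewrite unfold_in /= => /orP[/eqP->|/eqP->]; [left|right; rewrite mulrN1z].
Qed.

Lemma qconj_eps0_sqr : @qconj R K eps0 ^+ 2 = eps0 ^- 2.
Proof.
have e0 : (eps0 : K) ^+ 2 != 0.
  by rewrite sqrf_eq0 -emb_eq0 gt_eqF // (lt_trans ltr01) ?eps0_gt1.
apply: (mulIf e0); rewrite mulVf // -exprMn.
by have [->|->] := qconj_unit_eps0; rewrite ?sqrrN expr1n.
Qed.

(** [sqrtD] is, up to sign, the determinant of an integral basis and its
    conjugate, and conjugation exchanges the two columns. *)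
Lemma qconj_sqrtD : @qconj R K sqrtD = - sqrtD.
Proof.
have [x [y [_ dxy]]] := discP K.
have cd : qconj (x * qconj y - qconj x * y) = - (x * qconj y - qconj x * y).
  by rewrite rmorphB !rmorphM !qconjK opprB mulrC [y * _]mulrC.
move/eqP: dxy; rewrite -sqrtD_sqr eqf_sqr => /orP[/eqP<-//|/eqP dE].
by apply: (@oppr_inj K); rewrite -rmorphN -dE.
Qed.

(** [x - x'] is the determinant of the pair [x, 1] and its conjugate, hence an
    integral multiple of the determinant [+-sqrtD] of an integral basis. *)
Lemma ringInt_diff_disc x : ringInt x ->
  exists z : int, x - qconj x = sqrtD * z%:~R.
Proof.
move=> Ox; have [b1 [b2 [[Ob1 Ob2 Ob] db]]] := discP K.
have [[a1 a2] [/= aE _]] := (Ob 1).1 (@ringInt1 K).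
have [[c1 c2] [/= cE _]] := (Ob x).1 Ox.
have xE : x - qconj x = (b1 * qconj b2 - qconj b1 * b2) *
    (a2 * c1 - a1 * c2)%:~R.
  have c1E : 1 = qconj b1 * a1%:~R + qconj b2 * a2%:~R.
    by rewrite -[LHS](rmorph1 (@qconj R K)) {1}aE rmorphD !rmorphMz !mulrzr.
  have cxE : qconj x = qconj b1 * c1%:~R + qconj b2 * c2%:~R.
    by rewrite {1}cE rmorphD !rmorphMz !mulrzr.
  transitivity (x * (qconj b1 * a1%:~R + qconj b2 * a2%:~R)
    - qconj x * (b1 * a1%:~R + b2 * a2%:~R)).
    by rewrite -c1E !mulrzr -aE !mulr1.
  rewrite cxE [in LHS]cE -[b1 *~ c1]mulrzr -[b2 *~ c2]mulrzr intrB !intrM.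
  move: (qconj b1) (qconj b2) a1%:~R a2%:~R c1%:~R c2%:~R => p1 p2 A1 A2 C1 C2.
  by ring.
move/eqP: db; rewrite -sqrtD_sqr eqf_sqr => /orP[/eqP dE|/eqP dE].
  by exists (a2 * c1 - a1 * c2); rewrite xE dE.
by exists (- (a2 * c1 - a1 * c2)); rewrite xE dE rmorphN mulrN mulNr.
Qed.

(** Products of [mu], an element of [a] and an element of the inverse different
    become integral when multiplied by [sqrtD], and the trace of a quotient
    [o / sqrtD] with [o] integral is the integer [(o - o') / sqrtD]. *)
Lemma trace_int (a : set K) l mu w :
  ideal_mul a (ideal_inv (@different R K)) l -> ideal_inv a mu -> ringInt w ->
  exists z : int, qtrace (l * mu * w) = z%:~R.
Proof.
move=> [s [sP ->]] amu Ow.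
set x := _ * w; have Ox : ringInt (sqrtD * x).
  rewrite /x mulr_suml mulr_suml mulr_sumr; apply: ringInt_sum => p /sP[ap dp].
  have -> : sqrtD * (p.1 * p.2 * mu * w) = mu * p.1 * (p.2 * (sqrtD * 1)) * w.
    by rewrite mulr1; ring.
  apply: ringIntM Ow; apply: ringIntM; first exact: amu.
  by apply: dp; exists 1; [exact: ringInt1|].
have [z zE] := ringInt_diff_disc Ox; exists z.
apply: (mulfI sqrtD_neq0); rewrite -zE rmorphM qconj_sqrtD /qtrace.
by rewrite mulrDr mulNr opprK.
Qed.

End QuadField.

(** * Orbits of the squares of the units *)

Section UnitOrbits.
Variables (R : realType) (K : realQuadField R).
Implicit Types l mu gam : K.

(** The generator of the group of squares of units, and its real value. *)
Definition eps2 : K := eps0 ^+ 2.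
Definition Eps2 : R := emb eps2.

Lemma Eps2_gt1 : 1 < Eps2.
Proof. by rewrite /Eps2 rmorphXn /= exprn_egt1 // eps0_gt1. Qed.

Lemma Eps2_gt0 : 0 < Eps2.
Proof. exact: lt_trans ltr01 Eps2_gt1. Qed.

Lemma eps2_neq0 : eps2 != 0.
Proof. by rewrite -emb_eq0 gt_eqF // Eps2_gt0. Qed.

Lemma emb_eps2z (k : int) : emb (eps2 ^ k) = Eps2 ^ k.
Proof. by rewrite fmorphXz. Qed.

Lemma qconj_eps2z (k : int) : qconj (eps2 ^ k) = eps2 ^ (- k).
Proof. by rewrite fmorphXz rmorphXn /= qconj_eps0_sqr exprz_inv. Qed.

Lemma emb_orbit k l : emb (eps2 ^ k * l) = Eps2 ^ k * emb l.
Proof. by rewrite rmorphM /= emb_eps2z. Qed.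

Lemma emb_qconj_orbit k l :
  emb (qconj (eps2 ^ k * l)) = Eps2 ^ (- k) * emb (qconj l).
Proof. by rewrite rmorphM /= qconj_eps2z emb_orbit. Qed.

Lemma ringInt_eps2z k : ringInt (eps2 ^ k).
Proof.
have [] : unitInt (eps2 ^ k) by apply/unitIntP; exists (2 * k); left; rewrite -exprz_exp.
by [].
Qed.

Lemma unit_sqr (eta : K) : unitInt eta -> exists k : int, eta ^+ 2 = eps2 ^ k.
Proof.
move/unitIntP => [k ek]; exists k.
have -> : eta ^+ 2 = (eps0 ^ k) ^+ 2 by case: ek => ->; rewrite ?sqrrN.
by rewrite /eps2 !exprnP !exprz_exp mulrC.
Qed.

Variables (a : set K) (m : nat).
Hypothesis a_ideal : frac_ideal a.
Local Notation Lam := (Lambda_plus a m).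

(** The common value of [- N l] on [Lambda_plus a m]. *)
Definition negnorm : R := - emb (- (m%:R * ratr (ideal_norm a) / (disc K)%:~R) : K).

Lemma LambdaP l : Lam l ->
  [/\ 0 < emb l, emb (qconj l) < 0 & emb l * - emb (qconj l) = negnorm].
Proof.
move=> [_ Nl l0]; have nl : emb l * - emb (qconj l) = negnorm.
  by rewrite mulrN -rmorphM -[l * _]/(qnorm l) Nl.
split=> //; have : 0 <= emb l * - emb (qconj l).
  rewrite nl /negnorm rmorphN opprK rmorphM fmorphV [X in 0 <= X / _]rmorphM.
  rewrite [emb (ratr _)]fmorph_rat rmorph_nat.
  have D0 : 0 <= emb ((disc K)%:~R : K) by rewrite -sqrtD_sqr rmorphXn sqr_ge0.
  apply: divr_ge0 D0; rewrite mulr_ge0 // ler0q /ideal_norm.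
  by rewrite divr_ge0.
rewrite pmulr_rge0 // oppr_ge0 le_eqVlt emb_eq0 qconj_eq0 => /orP[/eqP lE|//].
by rewrite lE rmorph0 ltxx in l0.
Qed.

Lemma expr_unbounded (B x : R) : 1 < x -> exists n, B < x ^+ n.
Proof.
move=> x1; have bern n : 1 + n%:R * (x - 1) <= x ^+ n.
  elim: n => [|n IH]; first by rewrite mul0r addr0 expr0.
  rewrite exprS -natr1; apply: (@le_trans _ _ (x * (1 + n%:R * (x - 1)))).
    rewrite -subr_ge0 [leRHS](_ : _ = n%:R * (x - 1) ^+ 2); last by ring.
    by rewrite mulr_ge0 ?sqr_ge0.
  by rewrite ler_pM2l // (lt_trans ltr01).
exists (Num.bound (B / (x - 1))); apply: lt_le_trans (bern _).
have x10 : 0 < x - 1 by rewrite subr_gt0.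
have [B0|B0] := leP 0 B.
  have := archi_boundP (divr_ge0 B0 (ltW x10)).
  by rewrite ltr_pdivrMr // => /lt_trans; apply; rewrite ltrDr.
by apply: (lt_le_trans B0); rewrite addr_ge0 // mulr_ge0 // ltW.
Qed.

Lemma Lambda_orbit k l : Lam l -> Lam (eps2 ^ k * l).
Proof.
move=> [al nl l0]; split.
- move: al => [s [sP ->]].
  exists [seq (eps2 ^ k * p.1, p.2) | p <- s]; split.
    move=> _ /mapP[p /sP[ap bp] ->] /=; split => //.
    by case: a_ideal => _ aM _ _; apply: aM => //; exact: ringInt_eps2z.
  by rewrite big_map mulr_sumr; apply: eq_bigr => p _ /=; rewrite mulrA.
- rewrite -nl /qnorm rmorphM /= qconj_eps2z mulrACA -expfzDr ?eps2_neq0//.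
  by rewrite subrr expr0z mul1r.
- by rewrite emb_orbit mulr_gt0 // exprz_gt0 // Eps2_gt0.
Qed.

Section Weyl.
Variable gam : K.
Hypothesis gam_pos : totally_positive gam.
Local Notation gamw := (emb gam, emb (qconj gam)).
Local Notation T l := (trw l gamw).

Lemma trw_mono k j l : Lam l -> k <= j -> T (eps2 ^ k * l) <= T (eps2 ^ j * l).
Proof.
move=> /LambdaP[x0 y0 _] kj; have [g0 g0'] := gam_pos.
rewrite /trw /= !emb_orbit !emb_qconj_orbit lerD // ler_pM2r //.
  by rewrite ler_pM2r // ler_weXz2l // ltW // Eps2_gt1.
by rewrite ler_nM2r // ler_weXz2l ?lerN2 // ltW // Eps2_gt1.
Qed.

(** Along an orbit of the squares of the units the trace form is increasing, so
    that the minimality in the definition of [Rset] says exactly that the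
    preceding element of the orbit has negative trace. *)
Lemma RsetE l : Rset a m gamw l <->
  [/\ Lam l, 0 <= T l & T (eps2 ^ (- 1) * l) < 0].
Proof.
split=> [[Ll Tl min]|[Ll Tl Tl']]; split=> //.
  rewrite ltNge; apply/negP => Tl'.
  have ue : unitInt (eps0 ^ (- 1) : K) by apply/unitIntP; exists (-1); left.
  have eE : (eps0 ^ (- 1) : K) ^+ 2 = eps2 ^ (- 1).
    by rewrite -!invr_expz ?expr1z exprVn.
  have := min _ ue; rewrite eE => /(_ Tl'); rewrite emb_orbit.
  have [x0 _ _] := LambdaP Ll.
  rewrite -ler_pdivrMr // divff ?gt_eqF // -(expr0z Eps2) ler_eXz2l //.
  exact: Eps2_gt1.
move=> eta /unit_sqr[k ->] Tk.
have [k0|k0] := leP 0 k.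
  have [x0 _ _] := LambdaP Ll.
  rewrite emb_orbit; apply: ler_peMl; first exact: ltW.
  by rewrite -(expr0z Eps2) ler_eXz2l // Eps2_gt1.
suff : T (eps2 ^ k * l) < 0 by rewrite ltNge Tk.
by apply: le_lt_trans Tl'; apply: trw_mono => //; lia.
Qed.

Lemma Rset_Lambda l : Rset a m gamw l -> Lam l.
Proof. by case. Qed.

Lemma trw_Rset_ge0 k l : Rset a m gamw l -> (0 <= T (eps2 ^ k * l)) = (0 <= k).
Proof.
move=> /RsetE[Ll Tl Tl']; have [k0|k0] := leP 0 k.
  apply: (le_trans Tl); rewrite -[X in T X <= _]mul1r -(expr0z eps2).
  exact: trw_mono.
apply/negbTE; rewrite -ltNge; apply: le_lt_trans Tl'; apply: trw_mono => //; lia.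
Qed.

Lemma Rset_orbit_inj k j l l' : Rset a m gamw l -> Rset a m gamw l' ->
  eps2 ^ k * l = eps2 ^ j * l' -> k = j /\ l = l'.
Proof.
move=> Rl Rl' E.
have shift i : (0 <= k + i) = (0 <= j + i).
  rewrite -(trw_Rset_ge0 _ Rl) -(trw_Rset_ge0 _ Rl').
  by rewrite ![_ + i]addrC !expfzDr ?eps2_neq0 // -!mulrA E.
have kj : k = j by have := shift (- k); have := shift (- j); lia.
split=> //; move: E; rewrite kj; apply: mulfI.
by rewrite expfz_neq0 ?eps2_neq0.
Qed.

(** The representative of an orbit is found as its first element of nonnegative
    trace; there is one because the traces tend to [+oo] and [-oo] at the two ends
    of the orbit. *)
Lemma Rset_cover l : Lam l -> exists kr : int * K,
  Rset a m gamw kr.2 /\ l = eps2 ^ kr.1 * kr.2.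
Proof.
move=> Ll; have [x0 y0 _] := LambdaP Ll; have [g0 g0'] := gam_pos.
set A := emb l * emb gam; set B := - emb (qconj l) * emb (qconj gam).
have A0 : 0 < A by rewrite mulr_gt0.
have B0 : 0 < B by rewrite mulr_gt0 // oppr_gt0.
have TE k : T (eps2 ^ k * l) = Eps2 ^ k * A - Eps2 ^ (- k) * B.
  by rewrite /trw /= emb_orbit emb_qconj_orbit /A /B; ring.
have Qge1 (n : nat) : 1 <= Eps2 ^+ n by rewrite exprn_ege1 // ltW // Eps2_gt1.
have Qle1 (n : nat) : Eps2 ^ (- n%:Z) <= 1.
  by rewrite -(expr0z Eps2) ler_eXz2l ?Eps2_gt1 // oppr_le0.
have [p pP] := expr_unbounded (B / A) Eps2_gt1.
have [n nP] := expr_unbounded (A / B) Eps2_gt1.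
(* the shift by [n] makes the trace negative at [j = 0] *)
pose P (j : nat) := 0 <= T (eps2 ^ (j%:Z - n%:Z) * l).
have P0 : ~~ P 0%N.
  rewrite /P sub0r TE opprK -ltNge subr_lt0 -exprnP.
  rewrite ltr_pdivrMr // in nP; apply: le_lt_trans nP.
  by rewrite ler_piMl // ltW.
have exP : exists j, P j.
  exists (p + n)%N; rewrite /P PoszD addrK TE subr_ge0 -exprnP.
  rewrite ltr_pdivrMr // in pP; apply: le_trans (ltW pP).
  by rewrite ler_piMl // ltW.
case: (ex_minnP exP) => [[|j] Pj jmin]; first by rewrite Pj in P0.
exists (n%:Z - j.+1%:Z, eps2 ^ (j.+1%:Z - n%:Z) * l); split=> /=; last first.
  rewrite mulrA -expfzDr ?eps2_neq0 //.
  by rewrite [X in _ ^ X](_ : _ = 0) ?expr0z ?mul1r //; lia.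
apply/RsetE; split=> //; first exact: Lambda_orbit.
rewrite mulrA -expfzDr ?eps2_neq0 // ltNge; apply/negP.
have -> : -1 + (j.+1%:Z - n%:Z) = j%:Z - n%:Z by lia.
by move=> /jmin; rewrite ltnn.
Qed.

End Weyl.

(** The integer [tr (l * mu)], as the floor of its real value. *)
Definition trint mu l : int := Num.floor (trw l (emb mu, emb (qconj mu))).

Lemma trw_qtrace mu l : trw l (emb mu, emb (qconj mu)) = emb (qtrace (l * mu)).
Proof. by rewrite /trw /qtrace rmorphD !rmorphM. Qed.

Lemma qtrace_trint mu l : Lam l -> ideal_inv a mu ->
  qtrace (l * mu) = (trint mu l)%:~R.
Proof.
move=> [al _ _] amu; have [z] := trace_int al amu (@ringInt1 K).
by rewrite mulr1 /trint trw_qtrace => ->; rewrite rmorph_int intrKfloor.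
Qed.

Lemma trw_trint mu l : Lam l -> ideal_inv a mu ->
  trw l (emb mu, emb (qconj mu)) = (trint mu l)%:~R.
Proof. by move=> Ll amu; rewrite trw_qtrace qtrace_trint // rmorph_int. Qed.

Section Basis.
Variables alpha beta : K.
Hypotheses (basis : zbasis (ideal_inv a) alpha beta).

Lemma basis_det : alpha * qconj beta - qconj alpha * beta != 0.
Proof.
have [aa ab span] := basis.
have a0 : ideal_inv a 0 by move=> y _; rewrite mul0r; exact: ringInt0.
have [c [_ cuniq]] := (span 0).1 a0.
have indep (i j : int) : alpha *~ i + beta *~ j = 0 -> i = 0 /\ j = 0.
  move=> /esym /(cuniq (i, j)) cij.
  have := cuniq (0, 0); rewrite !mulr0z addr0 => /(_ erefl); rewrite cij.
  by case.
have b0 : beta != 0.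
  apply/eqP => b0; have /indep[//] : alpha *~ 0 + beta *~ 1 = 0.
  by rewrite b0 mulr0z mul0rz addr0.
rewrite subr_eq0; apply/eqP => E.
have [|r rE] := @qconj_fixed _ _ (alpha / beta).
  rewrite fmorph_div; apply/eqP; rewrite eqr_div ?qconj_eq0 //.
  by rewrite -E.
have /indep[] : alpha *~ denq r + beta *~ (- numq r) = 0.
  have d0 : ((denq r)%:~R : K) != 0.
    by rewrite -emb_eq0 rmorph_int intr_eq0 denq_neq0.
  have := rE; rewrite /ratr => /eqP; rewrite eqr_div // => /eqP rE'.
  rewrite mulrNz -(mulrzr alpha) -(mulrzr beta) rE'.
  by rewrite mulrC subrr.
by move/eqP; rewrite (negPf (denq_neq0 r)).
Qed.

(** The trace form of [K] is nondegenerate. *)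
Lemma trace_inj x : qtrace (x * alpha) = 0 -> qtrace (x * beta) = 0 -> x = 0.
Proof.
rewrite /qtrace !rmorphM => /eqP; rewrite addr_eq0 => /eqP xa /eqP.
rewrite addr_eq0 => /eqP xb; apply: (mulIf basis_det).
rewrite mul0r mulrBr mulrA xa [qconj alpha * beta]mulrC mulrA xb.
by ring.
Qed.

Hypotheses (alpha_pos : totally_positive alpha) (beta_pos : totally_positive beta).

(** In the strip both embeddings are bounded, the product of the two being fixed;
    so are the two integral traces, which determine [l]. *)
Lemma Lambda_strip_finite (d M : R) : 0 < d ->
  finite_set [set l | Lam l /\ d <= emb l <= M].
Proof.
move=> d0; have [aa ab _] := basis.
pose S := [set l | Lam l /\ d <= emb l <= M].
pose f l : int * int := (trint alpha l, trint beta l).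
have finj : {in S &, injective f}.
  move=> l l' /set_mem[Ll _] /set_mem[Ll' _] [fa fb].
  apply/eqP; rewrite -subr_eq0; apply/eqP; apply: trace_inj.
    rewrite mulrBl /qtrace rmorphB addrACA -opprD -/(qtrace _) -/(qtrace (l' * _)).
    by rewrite !qtrace_trint // fa subrr.
  rewrite mulrBl /qtrace rmorphB addrACA -opprD -/(qtrace _) -/(qtrace (l' * _)).
  by rewrite !qtrace_trint // fb subrr.
have fbound mu : totally_positive mu -> ideal_inv a mu ->
    exists B : nat, forall l, S l -> `|trint mu l| <= B%:Z.
  move=> [mu0 mu0'] amu.
  pose b := `|M * emb mu| + `|negnorm / d * emb (qconj mu)|.
  exists (Num.bound b) => l [Ll /andP[dl lM]].
  rewrite -(ler_int R) intr_norm -trw_trint //.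
  apply: le_trans (ltW (archi_boundP (_ : 0 <= b))); last by rewrite addr_ge0.
  have [x0 y0 xy] := LambdaP Ll.
  apply: le_trans (ler_normD _ _) _; apply: lerD => /=.
    rewrite !normrM ler_pM2r ?normr_gt0 ?gt_eqF // gtr0_norm //.
    by rewrite (le_trans lM) ?ler_norm.
  rewrite !normrM ler_pM2r ?normr_gt0 ?gt_eqF // ltr0_norm // -xy.
  rewrite -normrM ger0_norm; last first.
    by rewrite divr_ge0 ?mulr_ge0 ?oppr_ge0 ?ltW.
  rewrite ler_pdivlMr // mulrC ler_pM2r ?oppr_gt0 //.
have [Ba Ba_] := fbound _ alpha_pos aa.
have [Bb Bb_] := fbound _ beta_pos ab.
pose I (B : nat) := (fun k : nat => k%:Z - B%:Z) @` `I_(B + B).+1.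
have inI B (z : int) : `|z| <= B%:Z -> I B z.
  move=> zB; exists (absz (z + B%:Z)) => /=; last by lia.
  by lia.
have fI B : finite_set (I B) by apply: finite_image; exact: finite_II.
have : finite_set (f @` S).
  apply: sub_finite_set (finite_setX (fI Ba) (fI Bb)).
  by move=> _ [l Sl <-]; split; apply: inI; [apply: Ba_|apply: Bb_].
by rewrite (eq_finite_set (inj_card_eq finj)).
Qed.

(** The inequalities of [RsetE] confine [emb l ^ 2] between two positive
    constants. *)
Lemma Rset_finite gam : totally_positive gam ->
  finite_set (Rset a m (emb gam, emb (qconj gam))).
Proof.
move=> gam_pos; have [g0 g0'] := gam_pos.
have [-> //|/set0P[l0 Rl0]] :=
  eqVneq (Rset a m (emb gam, emb (qconj gam))) set0.
have [x0 y0 xy0] := LambdaP (Rset_Lambda Rl0).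
have c0 : 0 < negnorm by rewrite -xy0 mulr_gt0 // oppr_gt0.
set s := negnorm * emb (qconj gam) / emb gam.
have s0 : 0 < s by rewrite divr_gt0 ?mulr_gt0.
apply: sub_finite_set (Lambda_strip_finite (Eps2 ^+ 2 * s + 1)
  (_ : 0 < Num.min 1 s)); last by rewrite lt_min ltr01 s0.
move=> l /(RsetE gam_pos)[Ll Tl Tl']; split=> //.
have [x1 y1 xy1] := LambdaP Ll; have Q0 := Eps2_gt0.
have E : s * emb gam = emb l * - emb (qconj l) * emb (qconj gam).
  by rewrite xy1 /s divfK // gt_eqF.
have sx : s <= emb l ^+ 2.
  rewrite -(ler_pM2r g0) E expr2 -!mulrA ler_pM2l //.
  by move: Tl; rewrite /trw /=; lra.
have xs : emb l ^+ 2 < Eps2 ^+ 2 * s.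
  rewrite -(ltr_pM2r g0) -[ltRHS]mulrA E.
  rewrite [ltLHS](_ : _ = emb l * (emb l * emb gam)); last by ring.
  rewrite [ltRHS](_ : _ =
    emb l * - (Eps2 ^+ 2 * emb (qconj l) * emb (qconj gam))); last by ring.
  rewrite ltr_pM2l // -subr_gt0.
  move: Tl'; rewrite /trw /= emb_orbit emb_qconj_orbit opprK expr1z.
  rewrite exprN1 -(ltr_pM2l Q0) mulr0 mulrDr !mulrA divff ?gt_eqF // mul1r.
  by rewrite expr2; lra.
rewrite ge_min; apply/andP; split.
  by have [//|x1'] := leP 1 (emb l); apply: (le_trans sx); nra.
by nra.
Qed.

End Basis.
End UnitOrbits.

(** * Sums along the orbits *)

Section OrbitSums.
Variables (R : realType) (K : realQuadField R) (a : set K) (m : nat).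
Variables alpha beta : K.
Hypotheses (a_ideal : frac_ideal a) (basis : zbasis (ideal_inv a) alpha beta).
Hypotheses (alpha_pos : totally_positive alpha).
Hypotheses (beta_pos : totally_positive beta).
Implicit Types l mu gam : K.
Local Notation Lam := (Lambda_plus a m).
Local Notation Q := (Eps2 K).
Local Notation T gam l := (trw l (emb gam, emb (qconj gam))).
Local Notation Rep gam := (Rset a m (emb gam, emb (qconj gam))).

(** An exhaustion of [Lambda_plus a m] by finite pieces that are symmetric about
    the representatives, so that geometric series can be summed on them. *)
Definition orbit_box gam (N : nat) : seq K :=
  [seq eps2 K ^ (k%:Z - N%:Z) * r | r <- fset_set (Rep gam), k <- iota 0 (N + N)].

Section Box.
Variable gam : K.
Hypothesis gam_pos : totally_positive gam.

Let finRep : finite_set (Rep gam).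
Proof. exact: Rset_finite basis alpha_pos beta_pos _ gam_pos. Qed.

Let mem_Rep r : (r \in fset_set (Rep gam)) -> Rep gam r.
Proof. by rewrite in_fset_set // => /set_mem. Qed.

Lemma orbit_box_Lambda N l : l \in orbit_box gam N -> Lam l.
Proof.
by case/allpairsP => -[r k] /= [/mem_Rep[Lr _ _] _ ->]; exact: Lambda_orbit.
Qed.

Lemma orbit_box_uniq N : uniq (orbit_box gam N).
Proof.
apply: allpairs_uniq; [exact: fset_uniq|exact: iota_uniq|].
move=> [r k] [r' k'] /allpairsP[[r1 k1] /= [/mem_Rep R1 _ [-> ->]]].
move=> /allpairsP[[r2 k2] /= [/mem_Rep R2 _ [-> ->]]].
by move/(Rset_orbit_inj gam_pos R1 R2) => [kk <-]; congr pair; lia.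
Qed.

Lemma orbit_box_cover (s : seq K) : (forall l, l \in s -> Lam l) ->
  exists N0, forall N, (N0 <= N)%N -> {subset s <= orbit_box gam N}.
Proof.
elim: s => [|l s IH] sL; first by exists 0%N.
have [|N1 N1P] := IH; first by move=> x xs; apply: sL; rewrite inE xs orbT.
have [[k r] /= [Rr lE]] := Rset_cover a_ideal gam_pos (sL l (mem_head _ _)).
exists (maxn N1 (absz k).+1) => N NP x; rewrite inE => /predU1P[->|xs]; last first.
  by apply: N1P xs; lia.
apply/allpairsP; exists (r, absz (k + N%:Z)) => /=; split.
- by rewrite in_fset_set //; exact: mem_set.
- rewrite mem_iota /=; lia.
- by rewrite lE; congr (_ ^ _ * _); lia.
Qed.

Lemma sum_orbit_box (f : K -> R) N : \sum_(l <- orbit_box gam N) f l =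
  \sum_(r <- fset_set (Rep gam)) \sum_(0 <= k < N + N)
    f (eps2 K ^ (k%:Z - N%:Z) * r).
Proof.
by rewrite big_allpairs_dep; apply: eq_bigr => r _; rewrite /index_iota subn0.
Qed.

End Box.

(** A decaying weight whose sum along an orbit [l * Q ^ k] telescopes up to a
    constant factor. *)
Definition weight (x : R) : R := x / (1 + x) ^+ 2.

Lemma weight_ge0 x : 0 < x -> 0 <= weight x.
Proof. by move=> x0; rewrite divr_ge0 ?sqr_ge0 // ltW. Qed.

(** The right side is an increment of [x / (1 + x)], which lies between [0]
    and [1]. *)
Lemma weight_telescope x : 0 < x ->
  weight x <= Q / (Q - 1) * (Q * x / (1 + Q * x) - x / (1 + x)).
Proof.
move=> x0; have Q1 := Eps2_gt1 K; have Q0 := Eps2_gt0 K.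
have Qx : 0 < Q * x by rewrite mulr_gt0.
have x1 : 0 < 1 + x by lra.
have Qx1 : 0 < 1 + Q * x by lra.
have -> : Q / (Q - 1) * (Q * x / (1 + Q * x) - x / (1 + x)) =
   Q * x / ((1 + Q * x) * (1 + x)).
  by field; rewrite !gt_eqF // subr_gt0.
rewrite /weight ler_pdivrMr ?exprn_gt0 // mulrAC ler_pdivlMr ?mulr_gt0 //.
by rewrite expr2; nra.
Qed.

Lemma weight_bounded : exists2 B, 0 <= B & forall A : {fset K},
  \sum_(l <- A | l \in Lam) weight (emb l) <= B.
Proof.
have Q1 := Eps2_gt1 K; have Q0 := Eps2_gt0 K.
have C0 : 0 <= Q / (Q - 1) by rewrite divr_ge0 // ?subr_ge0 ltW.
exists (\sum_(r <- fset_set (Rep alpha)) Q / (Q - 1)); first exact: sumr_ge0.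
move=> A; rewrite -big_filter.
have [N /(_ _ (leqnn N)) AN] : exists N0, forall N, (N0 <= N)%N ->
    {subset [seq l <- A | l \in Lam] <= orbit_box alpha N}.
  apply: orbit_box_cover => // l; rewrite mem_filter => /andP[/set_mem //].
have wge0 l : l \in orbit_box alpha N -> 0 <= weight (emb l).
  by move=> /(orbit_box_Lambda alpha_pos)/LambdaP[x0 _ _]; exact: weight_ge0.
have -> : \sum_(l <- [seq l <- A | l \in Lam]) weight (emb l) =
   \sum_(l <- orbit_box alpha N | l \in [seq l <- A | l \in Lam]) weight (emb l).
  rewrite -[RHS]big_filter; apply: perm_big; apply: uniq_perm.
  - by apply: filter_uniq; exact: fset_uniq.
  - by apply: filter_uniq; exact: orbit_box_uniq.
  - move=> l; rewrite [RHS]mem_filter.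
    by apply/idP/andP => [/[dup] lA /AN lN|[]].
apply: (@le_trans _ _ (\sum_(l <- orbit_box alpha N) weight (emb l))).
  rewrite [leRHS](bigID (mem [seq l <- A | l \in Lam])) /= lerDl.
  by rewrite big_seq_cond sumr_ge0 // => l /andP[lN _]; exact: wge0.
rewrite sum_orbit_box [leLHS]big_seq [leRHS]big_seq; apply: ler_sum => r rR.
have Lr : Lam r.
  move: rR; rewrite in_fset_set; first by move=> /set_mem; exact: Rset_Lambda.
  exact: Rset_finite basis alpha_pos beta_pos _ alpha_pos.
have [x0 _ _] := LambdaP Lr.
(* the telescoping quantity of [weight_telescope] at the [k]-th orbit element *)
pose F (k : nat) : R := let x := Q ^ (k%:Z - N%:Z) * emb r in x / (1 + x).
apply: (@le_trans _ _ (\sum_(0 <= k < N + N) Q / (Q - 1) * (F k.+1 - F k))).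
  apply: ler_sum => k _; rewrite emb_orbit.
  apply: le_trans (weight_telescope _) _; first by rewrite mulr_gt0 ?exprz_gt0.
  rewrite /F mulrA -{1 3}(expr1z Q) -expfzDr ?gt_eqF //.
  by have -> : 1 + (k%:Z - N%:Z) = k.+1%:Z - N%:Z by lia.
rewrite -mulr_sumr telescope_sumr // -[leRHS]mulr1 ler_wpM2l //.
have Fge0 k : 0 <= F k.
  by rewrite /F divr_ge0 ?addr_ge0 // mulr_ge0 // ?exprz_ge0 // ltW.
have Fle1 k : F k <= 1.
  have p : 0 < Q ^ (k%:Z - N%:Z) * emb r by rewrite mulr_gt0 ?exprz_gt0.
  by rewrite /F ler_pdivrMr ?mul1r ?lerDr // addr_gt0.
have := Fge0 0%N; have := Fle1 (N + N)%N; lra.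
Qed.

(** For [mu = gam] this is the minimum of [emb l * emb mu] and of
    [- emb (qconj l) * emb (qconj mu)], that is the exponent of the factor common
    to the two terms of the factor of [l].  Deciding by the sign of the trace of
    [l * gam] makes it linear in [mu] and geometric on each half of an orbit. *)
Definition common_exponent gam mu l : R :=
  if 0 <= T gam l then - emb (qconj l) * emb (qconj mu) else emb l * emb mu.

(** On an orbit with representative [r], the first half is a geometric series with
    sum [r mu / (eps0 ^ 2 - 1)] up to the factor [1 - Q ^- N], and the second half
    is one with sum the conjugate of this number. *)
Lemma sum_common_exponent_box gam mu N : totally_positive gam ->
  \sum_(l <- orbit_box gam N) common_exponent gam mu l =
  (1 - Q ^- N) * emb (qtrace (weylK a m gam * mu)).
Proof.
move=> gam_pos; have Q1 := Eps2_gt1 K; have Q0 := Eps2_gt0 K.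
have finR := Rset_finite m basis alpha_pos beta_pos gam_pos.
rewrite sum_orbit_box.
have -> : emb (qtrace (weylK a m gam * mu)) = \sum_(r <- fset_set (Rep gam))
   (emb r * emb mu / (Q - 1) + emb (qconj r) * emb (qconj mu) / (Q^-1 - 1)).
  rewrite /weylK /weyl fsbig_finite //= /qtrace mulr_suml (raddf_sum (@qconj R K)).
  rewrite -big_split raddf_sum; apply: eq_bigr => r _ /=.
  have qE : @qconj R K (eps0 ^+ 2 - 1) = eps0 ^- 2 - 1.
    by rewrite rmorphB rmorph1 rmorphXn /= qconj_eps0_sqr.
  rewrite (mulrAC r) rmorphM fmorphV qE !rmorphD /= !rmorphM !fmorphV.
  by rewrite !rmorphB !rmorph1 fmorphV.
rewrite mulr_sumr [LHS]big_seq [RHS]big_seq; apply: eq_bigr => r rR.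
have Rr : Rep gam r by move: rR; rewrite in_fset_set // => /set_mem.
have geom (z : R) : z != 1 -> \sum_(0 <= k < N) z ^+ k = (z ^+ N - 1) / (z - 1).
  by move=> z1; rewrite big_mkord subrX1 mulrC mulKf // subr_eq0.
rewrite (@big_cat_nat _ _ _ N) ?leq_addr //=.
have shift (f : nat -> R) :
    \sum_(N <= k < N + N) f k = \sum_(0 <= k < N) f (k + N)%N.
  by rewrite -{1}[N]add0n big_addn addnK.
rewrite shift.
rewrite (eq_big_nat _ _ (F2 := fun k => Q ^+ k * (Q ^- N * (emb r * emb mu)))); last first.
  move=> k /andP[_ kN]; rewrite /common_exponent (trw_Rset_ge0 gam_pos _ Rr).
  have -> : (0 <= k%:Z - N%:Z) = false by lia.
  by rewrite emb_orbit expfzDr ?gt_eqF // -exprnP -invr_expz exprnP; ring.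
rewrite [X in _ + X](eq_big_nat _ _
    (F2 := fun k => Q^-1 ^+ k * - (emb (qconj r) * emb (qconj mu)))); last first.
  move=> k /andP[_ kN]; rewrite /common_exponent (trw_Rset_ge0 gam_pos _ Rr) PoszD addrK /=.
  by rewrite emb_qconj_orbit -exprz_inv -exprnP; ring.
have Qi1 : Q^-1 != 1 by rewrite lt_eqF // invf_lt1.
rewrite -!mulr_suml (geom Q) ?gt_eqF // (geom _ Qi1) exprVn.
rewrite [RHS]mulrDr; congr (_ + _); last by ring.
have QN : Q ^+ N != 0 by rewrite expf_neq0 // gt_eqF.
move: (Q ^+ N) QN => q q0; have : Q - 1 != 0 by rewrite subr_eq0 gt_eqF.
by move: (Q - 1) => p p0; field; rewrite p0 q0.
Qed.

End OrbitSums.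

(** * Complex numbers *)

Section ComplexModulus.
Variable R : realType.
Local Notation C := (Cplx R).
Implicit Types z w : C.

(** The modulus as a real number; the norm of [C] has its values in [C] itself. *)
Definition cabs z : R := Normc.normc z.
Arguments cabs : simpl never.

Lemma normCE z : `|z| = toC (cabs z).
Proof. by []. Qed.

Lemma cabsM z w : cabs (z * w) = cabs z * cabs w.
Proof. exact: Normc.normcM. Qed.

Lemma cabsD z w : cabs (z + w) <= cabs z + cabs w.
Proof. exact: le_normcD. Qed.

Lemma cabsN z : cabs (- z) = cabs z.
Proof. exact: normcN. Qed.

Lemma cabsC z w : cabs (z - w) = cabs (w - z).
Proof. by rewrite -cabsN opprB. Qed.

Lemma cabsB z w : cabs (z - w) <= cabs z + cabs w.
Proof. by rewrite -(cabsN w) cabsD. Qed.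

Lemma cabs0 : cabs (0 : C) = 0.
Proof. exact: Normc.normc0. Qed.

Lemma cabs1 : cabs (1 : C) = 1.
Proof. exact: Normc.normc1. Qed.

Lemma cabs_ge0 z : 0 <= cabs z.
Proof. by case: z => x y; exact: sqrtr_ge0. Qed.

Lemma cabsX z n : cabs (z ^+ n) = cabs z ^+ n.
Proof.
by elim: n => [|n IH]; rewrite ?expr0 ?cabs1 // !exprS cabsM IH.
Qed.

Lemma cabs_toC (x : R) : cabs (toC x) = `|x|.
Proof. by rewrite /cabs /= expr0n addr0 sqrtr_sqr. Qed.

Lemma cabs_eq0 z : (cabs z == 0) = (z == 0).
Proof.
by apply/eqP/eqP => [/Normc.eq0_normc//|->]; exact: cabs0.
Qed.

Lemma Re_le_cabs z : `|complex.Re z| <= cabs z.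
Proof.
by case: z => x y; rewrite /cabs /= -sqrtr_sqr ler_wsqrtr // lerDl sqr_ge0.
Qed.

Lemma Im_le_cabs z : `|complex.Im z| <= cabs z.
Proof.
by case: z => x y; rewrite /cabs /= -sqrtr_sqr ler_wsqrtr // lerDr sqr_ge0.
Qed.

Lemma cabs_le z : cabs z <= `|complex.Re z| + `|complex.Im z|.
Proof.
case: z => x y; rewrite /cabs /= -[leRHS]ger0_norm ?addr_ge0 // -sqrtr_sqr.
rewrite ler_wsqrtr // sqrrD !real_normK ?num_real // -addrA lerD2l lerDr.
by rewrite mulrn_wge0 // mulr_ge0.
Qed.

Lemma toC_le (x y : R) : (toC x <= toC y) = (x <= y).
Proof. exact: lecR. Qed.

Lemma toC_lt (x y : R) : (toC x < toC y) = (x < y).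
Proof. exact: ltcR. Qed.

Lemma toCM (x y : R) : toC (x * y) = toC x * toC y.
Proof. exact: (rmorphM (real_complex R)). Qed.

Lemma toCD (x y : R) : toC (x + y) = toC x + toC y.
Proof. exact: (rmorphD (real_complex R)). Qed.

Lemma toCN (x : R) : toC (- x) = - toC x.
Proof. exact: (rmorphN (real_complex R)). Qed.

Lemma posC_toC (e : C) : 0 < e -> exists2 x : R, 0 < x & e = toC x.
Proof.
move=> e0; have /RRe_real eE : e \is Num.real by exact: gtr0_real.
by exists (complex.Re e); rewrite ?eE // -toC_lt /toC eE.
Qed.

Lemma cvgC_cabs (T : Type) (F : set_system T) {FF : Filter F} (f : T -> C) (l : C) :
  (forall e : R, 0 < e -> \forall t \near F, cabs (l - f t) < e) <->
  f @ F --> l.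
Proof.
split=> [H|/cvgrPdist_lt H e e0].
  apply/cvgrPdist_lt => _ /posC_toC[e e0 ->]; have := H _ e0.
  by apply: filterS => t; rewrite normCE toC_lt.
have := H (toC e); rewrite -[0]/(toC 0) toC_lt => /(_ e0).
by apply: filterS => t; rewrite normCE toC_lt.
Qed.

Lemma cvgC_mulr (T : Type) (F : set_system T) {FF : Filter F} (f : T -> C) (a b : C) :
  f @ F --> a -> (fun t => f t * b) @ F --> a * b.
Proof. by move=> fa; apply: cvgM fa _; exact: cvg_cst. Qed.

Lemma cvgC_parts (T : Type) (F : set_system T) {FF : Filter F} (f g : T -> R)
    (x y : R) : f @ F --> x -> g @ F --> y ->
  (fun t => (f t +i* g t)%C : C) @ F --> ((x +i* y)%C : C).
Proof.
move=> /cvgrPdist_lt Hx /cvgrPdist_lt Hy; apply/cvgC_cabs => e e0.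
have e20 : 0 < e / 2 by rewrite divr_gt0.
apply: filterS2 (Hx _ e20) (Hy _ e20) => t xu yv.
by apply: le_lt_trans (cabs_le _) _; rewrite [e]splitr /= ltrD.
Qed.

(** Completeness of the complex numbers, from the completeness of the reals. *)
Lemma cauchyC_cvg (T : Type) (F : set_system T) {FF : ProperFilter F} (f : T -> C) :
  (forall e : R, 0 < e -> exists c, \forall t \near F, cabs (c - f t) < e) ->
  exists l : C, f @ F --> l.
Proof.
move=> H.
have part (g : C -> R) : (forall z w, `|g z - g w| <= cabs (z - w)) ->
    exists x : R, (g \o f) @ F --> x.
  move=> gL; suff /cauchy_cvgP : cauchy ((g \o f) @ F) by move=> ?; exists (lim ((g \o f) @ F)).
  apply: cauchy_exP => e e0; have [c Hc] := H _ e0; exists (g c).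
  by apply: filterS Hc => t; apply: le_lt_trans; exact: gL.
have [|x Hx] := part (@complex.Re R).
  by move=> [z z'] [w w']; exact: (Re_le_cabs (_ +i* _)%C).
have [|y Hy] := part (@complex.Im R).
  by move=> [z z'] [w w']; exact: (Im_le_cabs (_ +i* _)%C).
exists (x +i* y)%C; have := @cvgC_parts _ _ _ _ _ _ _ Hx Hy.
rewrite (_ : (fun t => _) = f) //; last first.
  by apply/funext => t /=; case: (f t).
exact.
Qed.

Lemma lim_cvgC (T : Type) (F : set_system T) {FF : ProperFilter F} (f : T -> C) l :
  f @ F --> l -> lim (f @ F) = l.
Proof. by apply: cvg_lim; exact: norm_hausdorff. Qed.

Lemma cvgC_cabs_le (T : Type) (F : set_system T) {FF : ProperFilter F}
    (f : T -> C) l (B : R) :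
  f @ F --> l -> (\forall t \near F, cabs (f t) <= B) -> cabs l <= B.
Proof.
move=> /cvgC_cabs fl fB; apply/ler_addgt0Pr => e e0.
have [t [le tB]] : exists t, cabs (l - f t) < e /\ cabs (f t) <= B.
  by apply: (@filter_ex _ F); near=> t; split; near: t; [exact: fl|].
rewrite -[l](subrK (f t)); apply: le_trans (cabsD _ _) _.
by rewrite addrC lerD // ltW.
Unshelve. all: by end_near. Qed.

End ComplexModulus.

Section ComplexExp.
Variable R : realType.
Local Notation C := (Cplx R).
Implicit Types z w : C.

Lemma cexpD z w : cexp (z + w) = cexp z * cexp w.
Proof.
case: z w => [a b] [c d]; rewrite /cexp /= expRD cosD sinD.
by apply/eqP; rewrite eq_complex /=; apply/andP; split; apply/eqP; ring.
Qed.

Lemma cabs_cexp z : cabs (cexp z) = expR (complex.Re z).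
Proof.
rewrite /cabs /= !exprMn -mulrDr cos2Dsin2 mulr1 sqrtr_sqr.
by rewrite ger0_norm // expR_ge0.
Qed.

Lemma cexp0 : cexp 0 = 1 :> C.
Proof.
by rewrite /cexp /= expR0 cos0 sin0 mulr1 mulr0.
Qed.

Lemma cexp_neq0 z : cexp z != 0.
Proof. by rewrite -cabs_eq0 cabs_cexp gt_eqF // expR_gt0. Qed.

Lemma cexpMn z n : cexp (z *+ n) = cexp z ^+ n.
Proof.
by elim: n => [|n IH]; rewrite ?mulr0n ?cexp0 // mulrS cexpD IH exprS.
Qed.

Lemma cexp_sum (I : Type) (s : seq I) (f : I -> C) :
  cexp (\sum_(i <- s) f i) = \prod_(i <- s) cexp (f i).
Proof.
by elim/big_rec2: _ => [|i y x _ <-]; rewrite ?cexp0 // cexpD.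
Qed.

Lemma cexp_period (k : int) : cexp (twopii R * k%:~R) = 1.
Proof.
have one : cexp (twopii R) = 1.
  by rewrite /cexp /twopii /= expR0 mulr_natl cos2pi sin2pi !mul1r.
rewrite mulrzr; case: k => k; first by rewrite -pmulrn cexpMn one expr1n.
apply: (mulIf (cexp_neq0 (twopii R *+ k.+1))).
by rewrite -cexpD NegzE mulrNz -pmulrn addNr cexp0 cexpMn one expr1n mulr1.
Qed.

Lemma cexp_cvg (T : Type) (F : set_system T) {FF : Filter F} (f g : T -> R)
    (x y : R) (s t : C) :
  f @ F --> x -> g @ F --> y ->
  cexp (toC (f i) * s + toC (g i) * t) @[i --> F] --> cexp (toC x * s + toC y * t).
Proof.
move=> fx gy; case: s t => s1 s2 [t1 t2].
have lin a b : f i * a + g i * b @[i --> F] --> x * a + y * b.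
  by apply: cvgD; apply: cvgMr_tmp.
have cexpE u v : cexp (toC u * (s1 +i* s2)%C + toC v * (t1 +i* t2)%C) =
    (expR (u * s1 + v * t1) * cos (u * s2 + v * t2) +i*
     (expR (u * s1 + v * t1) * sin (u * s2 + v * t2)))%C.
  by rewrite /cexp /= !mul0r !subr0 !addr0.
rewrite cexpE [X in nbhs (X @ F) `=>` _](_ : _ = fun i => (
    expR (f i * s1 + g i * t1) * cos (f i * s2 + g i * t2) +i*
     (expR (f i * s1 + g i * t1) * sin (f i * s2 + g i * t2)))%C); last first.
  by apply/funext => i; rewrite cexpE.
apply: cvgC_parts; apply: cvgM; apply: continuous_cvg (lin _ _).
- exact: continuous_expR.
- exact: continuous_cos.
- exact: continuous_expR.
- exact: continuous_sin.
Qed.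

End ComplexExp.

(** * Sums and products over all finite subsets *)

#[local] Existing Instance totally_filter.

Section Unconditional.
Variables (R : realType) (I : choiceType) (h : I -> R) (S : R).
Local Notation C := (Cplx R).
Hypotheses (h_ge0 : forall i, 0 <= h i).
Hypothesis sum_le : forall A : {fset I}, \sum_(i <- A) h i <= S.

Lemma near_totally (A0 : {fset I}) : \forall A \near totally, (A0 `<=` A)%fset.
Proof. by exists A0. Qed.

Lemma big_fset_sub (T : Type) (idx : T) (op : Monoid.com_law idx) (f : I -> T)
    (A0 A : {fset I}) : (A0 `<=` A)%fset ->
  \big[op/idx]_(i <- A) f i =
  op (\big[op/idx]_(i <- A0) f i) (\big[op/idx]_(i <- A | i \notin A0) f i).
Proof.
move=> A0A; rewrite (bigID (mem A0)) /=; congr (op _ _).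
rewrite -big_filter; apply: perm_big; apply: uniq_perm.
- by rewrite filter_uniq // fset_uniq.
- exact: fset_uniq.
- move=> i; rewrite mem_filter; apply/andP/idP => [[]//|iA]; split=> //.
  exact: (fsubsetP A0A).
Qed.

Lemma tail_small (e : R) : 0 < e -> exists A0 : {fset I}, forall A : {fset I},
  \sum_(i <- A | i \notin A0) h i <= e.
Proof.
move=> e0; pose E := [set x | exists A : {fset I}, x = \sum_(i <- A) h i].
have supE : has_sup E.
  split; first by exists (\sum_(i <- fset0) h i), fset0.
  by exists S => _ [A ->].
have [_ [A0 ->] lt] := sup_adherent e0 supE; exists A0 => A.
have : \sum_(i <- (A0 `|` A)%fset) h i <= sup E.
  by apply: sup_ubound; [case: supE|exists (A0 `|` A)%fset].
rewrite (big_fset_sub _ _ (fsubsetUl A0 A)) /=.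
suff : \sum_(i <- A | i \notin A0) h i <=
  \sum_(i <- (A0 `|` A)%fset | i \notin A0) h i by lra.
rewrite [leLHS]big_mkcond [leRHS]big_mkcond (big_fset_sub _ _ (fsubsetUr A0 A)) /=.
by rewrite lerDl sumr_ge0 // => i _; case: ifP.
Qed.

Section Products.
Variable f : I -> C.
Hypothesis f_near1 : forall i, cabs (f i - 1) <= h i.

(** Expanding the product and taking absolute values turns [f i] into [1 + h i],
    and [1 + h <= exp h]. *)
Lemma prod_sub1_le (s : seq I) (P : pred I) :
  cabs (\prod_(i <- s | P i) f i - 1) <= expR (\sum_(i <- s | P i) h i) - 1.
Proof.
elim: s => [|i s IH]; first by rewrite !big_nil subrr cabs0 expR0 subrr.
rewrite !big_cons; case: ifP => // _.
set p := \prod_(_ <- _ | _) _ in IH *; set t := \sum_(_ <- _ | _) _ in IH *.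
have -> : f i * p - 1 = (f i - 1) * (p - 1) + (f i - 1) + (p - 1) by ring.
apply: le_trans (cabsD _ _) _; apply: le_trans (lerD (cabsD _ _) (lexx _)) _.
rewrite cabsM expRD; have := f_near1 i; have := expR_ge1Dx (h i).
have := cabs_ge0 (f i - 1); have := cabs_ge0 (p - 1); have := h_ge0 i.
by have := expR_gt0 t; nra.
Qed.

Lemma prod_le (s : seq I) (P : pred I) :
  cabs (\prod_(i <- s | P i) f i) <= expR (\sum_(i <- s | P i) h i).
Proof.
rewrite -[X in cabs X](subrK 1); apply: le_trans (cabsD _ _) _.
by rewrite cabs1 -lerBrDr prod_sub1_le.
Qed.

(** The Cauchy criterion: beyond a finite set [A0] that carries almost all of the
    sum of [h], further factors change the product by a factor close to [1]. *)
Lemma prod_cvg : exists l : C, (fun A : {fset I} => \prod_(i <- A) f i) @ totally --> l.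
Proof.
apply: cauchyC_cvg => e e0.
have M0 := expR_gt0 S.
(* [expR t - 1 <= 2 * t] for [t <= 1 / 2], and partial products are at most
   [expR S] *)
pose t := Num.min (1 / 2) (e / (4 * expR S)).
have t0 : 0 < t by rewrite lt_min divr_gt0 //= divr_gt0 // mulr_gt0.
have t12 : t <= 1 / 2 by rewrite ge_min lexx.
have te : t * (4 * expR S) <= e by rewrite -ler_pdivlMr ?mulr_gt0// ge_min lexx orbT.
have [A0 tailA0] := tail_small t0.
exists (\prod_(i <- A0) f i); apply: filterS (near_totally A0) => A A0A.
rewrite (big_fset_sub _ _ A0A) /= -{1}[X in X - _]mulr1 -mulrBr cabsM cabsC.
have le1 : cabs (\prod_(i <- A0) f i) <= expR S.
  by apply: le_trans (prod_le _ _) _; rewrite ler_expR.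
have le2 : cabs (\prod_(i <- A | i \notin A0) f i - 1) <= expR t - 1.
  by apply: le_trans (prod_sub1_le _ _) _; rewrite lerD2r ler_expR.
have expt : expR t - 1 <= 2 * t.
  have := expR_ge1Dx (- t); rewrite expRN => it.
  have : expR t * (1 - t) <= 1.
    by rewrite -[leRHS](@divff _ (expR t)) ?gt_eqF ?expR_gt0 // ler_pM2l ?expR_gt0.
  by have := expR_gt0 t; nra.
apply: (@le_lt_trans _ _ (expR S * (2 * t))); last by nra.
by apply: ler_pM; rewrite ?cabs_ge0 //; exact: le_trans le2 expt.
Qed.

End Products.

(** Absolute convergence lets the sum over all finite subsets be computed along
    one exhausting sequence of finite subsets. *)
Lemma sum_cvg_exhaust (theta : I -> R) (M V : R) (b : nat -> seq I) :
  (forall i, `|theta i| <= M * h i) -> (forall N, uniq (b N)) ->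
  (forall A : {fset I}, exists N0, forall N, (N0 <= N)%N ->
     forall i, i \in A -> theta i != 0 -> i \in b N) ->
  \sum_(i <- b N) theta i @[N --> \oo] --> V ->
  (fun A : {fset I} => \sum_(i <- A) theta i) @ totally --> V.
Proof.
move=> theta_le b_uniq b_cover /cvgrPdist_lt bV; apply/cvgrPdist_lt => e e0.
have M0 : 0 < `|M| + 1 by rewrite ltr_wpDl.
have t0 : 0 < e / 2 / (`|M| + 1) by rewrite !divr_gt0.
have [A0 tailA0] := tail_small t0.
have [N0 N0P] := b_cover A0.
have [N [NV NA0]] : exists N, `|V - \sum_(i <- b N) theta i| < e / 2 /\ (N0 <= N)%N.
  apply: (@filter_ex _ \oo); near=> N; split; near: N.
    by apply: bV; rewrite divr_gt0.
  exact: nbhs_infty_ge.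
pose A1 := [fset i in b N]%fset.
have bA1 : \sum_(i <- A1) theta i = \sum_(i <- b N) theta i.
  apply: perm_big; apply: uniq_perm => //.
  by move=> i; rewrite !inE.
apply: filterS (near_totally A1) => A A1A.
rewrite (big_fset_sub _ _ A1A) /= bA1 opprD addrA.
apply: le_lt_trans (ler_normB _ _) _; rewrite [e]splitr ltr_leD //.
apply: le_trans (ler_norm_sum _ _ _) _.
apply: (@le_trans _ _ (\sum_(i <- A | i \notin A0) (`|M| + 1) * h i)).
  rewrite [leLHS]big_mkcond [leRHS]big_mkcond; apply: ler_sum => i _.
  case: ifPn => [iA1|_]; last by case: ifP => // _; rewrite mulr_ge0 // ltW.
  have [iA0|iA0] := boolP (i \in A0) => /=.
    rewrite normr_le0; apply/eqP; apply: contraNeq iA1 => ti0.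
    by rewrite !inE (N0P _ NA0).
  apply: le_trans (theta_le i) _; rewrite ler_wpM2r //.
  by rewrite (le_trans (ler_norm M)) // lerDl.
by rewrite -mulr_sumr mulrC -ler_pdivlMr.
Unshelve. all: by end_near. Qed.

End Unconditional.

(** * Uniform Taylor expansions *)

Definition lin2 (R : realType) (c d : Cplx R) (h : Cplx R * Cplx R) : Cplx R :=
  c * h.1 + d * h.2.

Lemma lin2_is_linear (R : realType) (c d : Cplx R) :
  linear (lin2 c d : Cplx R * Cplx R -> (Cplx R)^o).
Proof. by move=> k [x y] [x' y']; rewrite /lin2 /= -![_ *: _]/(_ * _); ring. Qed.

HB.instance Definition _ (R : realType) (c d : Cplx R) :=
  GRing.isLinear.Build (Cplx R) (Cplx R * Cplx R)%type (Cplx R)^o _ (lin2 c d)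
    (lin2_is_linear c d).

(** A form of the definition of differentiability in which the candidate for the
    differential is explicit. *)
Lemma differentiable_remainder (K : numFieldType) (V W : normedModType K)
    (f : V -> W) (df : {linear V -> W}) (x : V) : continuous df ->
  (forall e : K, 0 < e -> \forall h \near (0 : V),
     `|f (h + x) - (f x + df h)| <= e * `|h|) ->
  differentiable f x.
Proof.
move=> dfc H.
have fo : f \o shift x = cst (f x) + df +o_ (0 : V) id by apply/eqaddoP.
by apply/diff_locallyP; rewrite (diff_unique dfc fo).
Qed.

Section Jets.
Variable R : realType.
Local Notation C := (Cplx R).
Implicit Types (p h : C * C) (f g : C * C -> C).

(** A first order Taylor expansion of [f] at [p] on the polydisc of radius
    [delta], with bounds for its three terms whose sum is at most [B]. *)
Definition jet_at (delta : R) p (B : R) f : Prop :=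
  exists a1 a2 : C, exists b0 b1 b2 : R,
  [/\ b0 + b1 + b2 <= B, cabs (f p) <= b0,
      (cabs a1 + cabs a2) * delta <= b1, 0 <= b2 &
      forall h x, 0 <= x <= 1 -> cabs h.1 <= x * delta -> cabs h.2 <= x * delta ->
        cabs (f (p + h) - (f p + lin2 a1 a2 h)) <= b2 * x ^+ 2].

Variables (delta : R) (p : C * C).
Hypothesis delta_gt0 : 0 < delta.
Local Notation jet := (jet_at delta p).

Lemma jet_le B B' f : B <= B' -> jet B f -> jet B' f.
Proof.
move=> BB' [a1 [a2 [b0 [b1 [b2 [bB f0 a b20 frem]]]]]].
by exists a1, a2, b0, b1, b2; split=> //; exact: le_trans BB'.
Qed.

Lemma jet_ge0 B f : jet B f -> 0 <= B.
Proof.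
move=> [a1 [a2 [b0 [b1 [b2 [bB f0 a b20 _]]]]]].
have : 0 <= (cabs a1 + cabs a2) * delta.
  by rewrite mulr_ge0 ?addr_ge0 ?cabs_ge0 // ltW.
have := cabs_ge0 (f p); lra.
Qed.

Lemma jet_cst (c : C) : jet (cabs c) (fun=> c).
Proof.
exists 0, 0, (cabs c), 0, 0; split=> //; rewrite ?cabs0 ?addr0 ?mul0r //.
by move=> h x _ _ _; rewrite /lin2 !mul0r !addr0 subrr cabs0.
Qed.

Lemma jet_fst r : cabs p.1 + delta <= r -> jet r fst.
Proof.
move=> pr; exists 1, 0, (cabs p.1), delta, 0; split=> //.
- by rewrite addr0.
- by rewrite cabs1 cabs0 addr0 mul1r.
- by move=> h x _ _ _; rewrite /lin2 /= !mul0r addr0 mul1r subrr cabs0.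
Qed.

Lemma jet_snd r : cabs p.2 + delta <= r -> jet r snd.
Proof.
move=> pr; exists 0, 1, (cabs p.2), delta, 0; split=> //.
- by rewrite addr0.
- by rewrite cabs1 cabs0 add0r mul1r.
- by move=> h x _ _ _; rewrite /lin2 /= !mul0r add0r mul1r subrr cabs0.
Qed.

Lemma jetD B B' f g : jet B f -> jet B' g -> jet (B + B') (fun q => f q + g q).
Proof.
move=> [a1 [a2 [b0 [b1 [b2 [bB f0 a b20 frem]]]]]].
move=> [a1' [a2' [b0' [b1' [b2' [bB' f0' a' b20' frem']]]]]].
exists (a1 + a1'), (a2 + a2'), (b0 + b0'), (b1 + b1'), (b2 + b2'); split.
- lra.
- by apply: le_trans (cabsD _ _) _; exact: lerD.
- apply: le_trans (lerD a a'); rewrite -mulrDl ler_wpM2r ?(ltW delta_gt0) //.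
  by have := cabsD a1 a1'; have := cabsD a2 a2'; lra.
- lra.
- move=> h x x01 h1 h2.
  rewrite [X in cabs X](_ : _ = f (p + h) - (f p + lin2 a1 a2 h) +
    (g (p + h) - (g p + lin2 a1' a2' h))); last by rewrite /lin2; ring.
  by apply: le_trans (cabsD _ _) _; rewrite mulrDl; apply: lerD; [exact: frem|exact: frem'].
Qed.

Lemma lin2_le a1 a2 b x h : (cabs a1 + cabs a2) * delta <= b -> 0 <= x ->
  cabs h.1 <= x * delta -> cabs h.2 <= x * delta -> cabs (lin2 a1 a2 h) <= b * x.
Proof.
move=> ab x0 h1 h2; apply: le_trans (cabsD _ _) _; rewrite !cabsM.
apply: (@le_trans _ _ ((cabs a1 + cabs a2) * delta * x)); last exact: ler_wpM2r.
have := ler_wpM2l (cabs_ge0 a1) h1; have := ler_wpM2l (cabs_ge0 a2) h2; nra.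
Qed.

(** The bounds of the product are those of a product of polynomials in the
    relative size [x] of the displacement, truncated by [x <= 1]; this is why
    bounds of products are products of bounds. *)
Lemma jetM B B' f g : jet B f -> jet B' g -> jet (B * B') (fun q => f q * g q).
Proof.
move=> jf jg; have B0 := jet_ge0 jf.
case: jf => [a1 [a2 [b0 [b1 [b2 [bB f0 a b20 frem]]]]]].
case: jg => [a1' [a2' [b0' [b1' [b2' [bB' f0' a' b20' frem']]]]]].
have b00 : 0 <= b0 by exact: le_trans (cabs_ge0 _) f0.
have b00' : 0 <= b0' by exact: le_trans (cabs_ge0 _) f0'.
have b10 : 0 <= b1.
  by apply: le_trans a; rewrite mulr_ge0 ?addr_ge0 ?cabs_ge0 // ltW.
have b10' : 0 <= b1'.
  by apply: le_trans a'; rewrite mulr_ge0 ?addr_ge0 ?cabs_ge0 // ltW.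
exists (f p * a1' + g p * a1), (f p * a2' + g p * a2).
exists (b0 * b0'), (b0 * b1' + b1 * b0').
exists (b0 * b2' + b1 * b1' + b2 * b0' + b1 * b2' + b2 * b1' + b2 * b2'); split.
- apply: (@le_trans _ _ ((b0 + b1 + b2) * (b0' + b1' + b2'))).
    by rewrite le_eqVlt; apply/orP; left; apply/eqP; ring.
  by apply: ler_pM; rewrite ?addr_ge0.
- by rewrite cabsM ler_pM ?cabs_ge0.
- have c1 := cabsD (f p * a1') (g p * a1).
  have c2 := cabsD (f p * a2') (g p * a2).
  rewrite !cabsM in c1 c2.
  apply: (@le_trans _ _ (cabs (f p) * ((cabs a1' + cabs a2') * delta) +
    cabs (g p) * ((cabs a1 + cabs a2) * delta))).
    by rewrite !mulrA -mulrDl ler_wpM2r ?(ltW delta_gt0) //; lra.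
  have d0 := ltW delta_gt0.
  by rewrite [b1 * _]mulrC; apply: lerD; apply: ler_pM;
    rewrite ?cabs_ge0 // mulr_ge0 ?addr_ge0 ?cabs_ge0.
- by rewrite !addr_ge0 ?mulr_ge0.
- move=> h x /[dup] x01 /andP[x0 x1] h1 h2.
  pose l := lin2 a1 a2 h; pose l' := lin2 a1' a2' h.
  pose r := f (p + h) - (f p + l); pose r' := g (p + h) - (g p + l').
  have r1 : cabs r <= b2 * x ^+ 2 by exact: frem.
  have r2 : cabs r' <= b2' * x ^+ 2 by exact: frem'.
  have l1 : cabs l <= b1 * x by exact: lin2_le.
  have l2 : cabs l' <= b1' * x by exact: lin2_le.
  rewrite [X in cabs X](_ : _ = f p * r' + l * l' + r * g p + l * r' + r * l' + r * r');
    last by rewrite /r /r' /l /l' /lin2; ring.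
  have cM (z w : C) (s t : R) : cabs z <= s -> cabs w <= t -> cabs (z * w) <= s * t.
    by move=> zs wt; rewrite cabsM ler_pM ?cabs_ge0.
  have x2 : x ^+ 3 <= x ^+ 2 by rewrite exprS ler_piMl ?sqr_ge0.
  have x4 : x ^+ 4 <= x ^+ 2 by rewrite -[4%N]/(2 + 2)%N exprD ler_piMl ?sqr_ge0 ?expr_le1.
  clearbody r r' l l'; rewrite !mulrDl.
  apply: le_trans (cabsD _ _) _; apply: lerD; last first.
    apply: le_trans (cM _ _ _ _ r1 r2) _; rewrite mulrACA -exprD.
    by rewrite ler_wpM2l // mulr_ge0.
  apply: le_trans (cabsD _ _) _; apply: lerD; last first.
    apply: le_trans (cM _ _ _ _ r1 l2) _; rewrite mulrACA -exprSr.
    by rewrite ler_wpM2l // mulr_ge0.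
  apply: le_trans (cabsD _ _) _; apply: lerD; last first.
    apply: le_trans (cM _ _ _ _ l1 r2) _; rewrite mulrACA -exprS.
    by rewrite ler_wpM2l // mulr_ge0.
  apply: le_trans (cabsD _ _) _; apply: lerD; last first.
    by apply: le_trans (cM _ _ _ _ r1 f0') _; rewrite mulrAC.
  apply: le_trans (cabsD _ _) _; apply: lerD; last first.
    by apply: le_trans (cM _ _ _ _ l1 l2) _; rewrite mulrACA -expr2.
  by apply: le_trans (cM _ _ _ _ f0 r2) _; rewrite mulrA.
Qed.

Lemma jetX B f n : jet B f -> jet (B ^+ n) (fun q => f q ^+ n).
Proof.
move=> jf; elim: n => [|n IH].
  have -> : (fun q => f q ^+ 0) = fun=> 1 by apply/funext => q; rewrite expr0.
  by rewrite expr0 -(cabs1 R); exact: jet_cst.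
have -> : (fun q => f q ^+ n.+1) = fun q => f q * f q ^+ n.
  by apply/funext => q; rewrite exprS.
by rewrite exprS; exact: jetM.
Qed.

Lemma jet_prod (I : Type) (s : seq I) (B : I -> R) (f : I -> C * C -> C) :
  (forall i, jet (B i) (f i)) ->
  jet (\prod_(i <- s) B i) (fun q => \prod_(i <- s) f i q).
Proof.
move=> jf; elim: s => [|i s IH].
  rewrite big_nil (_ : (fun q => _) = fun=> 1); last first.
    by apply/funext => q; rewrite big_nil.
  by rewrite -(cabs1 R); exact: jet_cst.
rewrite big_cons (_ : (fun q => _) = fun q => f i q * \prod_(i <- s) f i q).
  by exact: jetM.
by apply/funext => q; rewrite big_cons.
Qed.

(** If difference quotients converge for each fixed step, with an error that is
    uniform in [t] and linear in the step, then the derivatives converge. *)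
Lemma derivatives_cvg (T : Type) (F : set_system T) {FF : ProperFilter F}
    (G : T -> R -> C) (g : R -> C) (a : T -> C) (B : R) :
  (forall t x, 0 <= x <= 1 -> cabs (G t x - (G t 0 + a t * toC x)) <= B * x ^+ 2) ->
  (forall x, 0 <= x <= 1 -> G ^~ x @ F --> g x) ->
  exists l : C, a @ F --> l.
Proof.
move=> aB Gg; apply: cauchyC_cvg => e e0.
have B0 : 0 <= B.
  have [t _] : exists t : T, True by apply: (@filter_ex _ F); exact: filterT.
  have := aB t 1; rewrite ler01 lexx => /(_ isT).
  by rewrite expr1n [B * _]mulr1 => aB1; exact: le_trans (cabs_ge0 _) aB1.
pose x := Num.min 1 (e / 2 / (B + 1)).
have B1 : 0 < B + 1 by rewrite ltr_wpDl.
have x0 : 0 < x by rewrite lt_min ltr01 !divr_gt0.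
have x1 : x <= 1 by rewrite ge_min lexx.
have xB : x * (B + 1) <= e / 2 by rewrite -ler_pdivlMr // ge_min lexx orbT.
have x01 : 0 <= x <= 1 by rewrite x1 ltW.
have zero01 : 0 <= (0 : R) <= 1 by rewrite lexx ler01.
have e4 : 0 < e * x / 4 by rewrite divr_gt0 // mulr_gt0.
(* a difference quotient of the limit with a step so small that its error is
   below [e / 2] *)
exists ((g x - g 0) / toC x).
have tx0 : toC x != 0 by rewrite -cabs_eq0 cabs_toC normr_eq0 gt_eqF.
have /cvgC_cabs/(_ _ e4) := Gg _ x01; have /cvgC_cabs/(_ _ e4) := Gg _ zero01.
apply: filterS2 => t g0 gx.
rewrite -(ltr_pM2r x0) -[X in _ * X < _](gtr0_norm x0) -cabs_toC -cabsM mulrBl divfK //.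
rewrite [X in cabs X](_ : _ = (g x - G t x) - (g 0 - G t 0) +
   (G t x - (G t 0 + a t * toC x))); last by ring.
apply: le_lt_trans (cabsD _ _) _.
have := cabsB (g x - G t x) (g 0 - G t 0); have := aB t x x01.
have : B * x ^+ 2 <= e / 2 * x by rewrite expr2 mulrA ler_wpM2r ?ltW //; nra.
lra.
Qed.

Lemma norm_pair_le (h : C * C) (e : R) : (`|h| <= toC e) = ((cabs h.1 <= e) && (cabs h.2 <= e)).
Proof.
rewrite prod_normE /= !normCE /Order.max toC_lt.
case: ltP => hh; rewrite toC_le; apply/idP/andP => [he|[]//]; split=> //.
  exact: le_trans (ltW hh) he.
exact: le_trans hh he.
Qed.

(** Expansions with uniform bounds pass to pointwise limits. *)
Lemma jet_limit_differentiable (T : Type) (F : set_system T) {FF : ProperFilter F}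
    (fA : T -> C * C -> C) (f : C * C -> C) (B : R) :
  (forall t, jet B (fA t)) ->
  (forall h, cabs h.1 <= delta -> cabs h.2 <= delta -> fA ^~ (p + h) @ F --> f (p + h)) ->
  differentiable f p.
Proof.
move=> jf fAf.
have /choice[a1 Ha1] : forall t, exists a1 : C, exists a2, forall h x, 0 <= x <= 1 ->
   cabs h.1 <= x * delta -> cabs h.2 <= x * delta ->
   cabs (fA t (p + h) - (fA t p + lin2 a1 a2 h)) <= B * x ^+ 2.
  move=> t; have [a1 [a2 [b0 [b1 [b2 [bB f0 a b20 frem]]]]]] := jf t.
  exists a1, a2 => h x x01 h1 h2; apply: le_trans (frem _ _ x01 h1 h2) _.
  rewrite ler_wpM2r ?sqr_ge0 //; apply: le_trans bB; rewrite lerDr addr_ge0 //.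
    exact: le_trans (cabs_ge0 _) f0.
  by apply: le_trans a; rewrite mulr_ge0 ?addr_ge0 ?cabs_ge0 // ltW.
have [a2 rem] := choice Ha1.
have td : toC delta != 0 by rewrite -cabs_eq0 cabs_toC normr_eq0 gt_eqF.
have size x : 0 <= x -> cabs (toC (x * delta)) <= x * delta.
  by move=> x0; rewrite cabs_toC ger0_norm // mulr_ge0 // ltW.
have size0 x : 0 <= x -> cabs (0 : C) <= x * delta.
  by move=> x0; rewrite cabs0 mulr_ge0 // ltW.
have xdelta x : 0 <= x <= 1 -> x * delta <= delta.
  by case/andP => x0 x1; rewrite ler_piMl // ltW.
have [l1 l1P] : exists l : C, (fun t => a1 t * toC delta) @ F --> l.
  apply: (@derivatives_cvg _ _ _ (fun t x => fA t (p + (toC (x * delta), 0)))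
     (fun x => f (p + (toC (x * delta), 0))) _ B) => [t x x01|x x01].
    have [x0 x1] := andP x01.
    have := rem t (toC (x * delta), 0) x x01 (size _ x0) (size0 _ x0).
    rewrite /lin2 /= mulr0 addr0 mul0r -[(toC 0, 0)]/(0 : C * C) addr0.
    by rewrite -mulrA -toCM [delta * x]mulrC.
  have [x0 x1] := andP x01; apply: fAf => /=; apply: le_trans (xdelta _ x01).
    exact: size.
  exact: size0.
have [l2 l2P] : exists l : C, (fun t => a2 t * toC delta) @ F --> l.
  apply: (@derivatives_cvg _ _ _ (fun t x => fA t (p + (0, toC (x * delta))))
     (fun x => f (p + (0, toC (x * delta)))) _ B) => [t x x01|x x01].
    have [x0 x1] := andP x01.
    have := rem t (0, toC (x * delta)) x x01 (size0 _ x0) (size _ x0).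
    rewrite /lin2 /= mulr0 add0r mul0r -[(0, toC 0)]/(0 : C * C) addr0.
    by rewrite -mulrA -toCM [delta * x]mulrC.
  have [x0 x1] := andP x01; apply: fAf => /=; apply: le_trans (xdelta _ x01).
    exact: size0.
  exact: size.
have cancel (b : T -> C) (l : C) :
    (fun t => b t * toC delta) @ F --> l -> b @ F --> l / toC delta.
  move=> bl; have bE : (fun t => b t * toC delta * (toC delta)^-1) = b.
    by apply/funext => t; rewrite mulfK.
  have : (fun t => b t * toC delta * (toC delta)^-1) @ F --> l / toC delta.
    exact: cvgC_mulr.
  by rewrite bE.
have a1P := cancel _ _ l1P; have a2P := cancel _ _ l2P.
pose L := lin2 (l1 / toC delta) (l2 / toC delta).
have fp : fA ^~ p @ F --> f p.
  have z0 : cabs (0 : C) <= delta by rewrite cabs0 ltW.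
  by have := fAf (0 : C * C) z0 z0; rewrite addr0.
have fL h x : 0 <= x <= 1 -> cabs h.1 <= x * delta -> cabs h.2 <= x * delta ->
    cabs (f (p + h) - (f p + L h)) <= B * x ^+ 2.
  move=> x01 h1 h2; have [x0 x1] := andP x01.
  apply: (@cvgC_cabs_le _ _ F _ (fun t => fA t (p + h) - (fA t p + lin2 (a1 t) (a2 t) h))).
    apply: cvgB; first by apply: fAf; apply: le_trans (xdelta _ x01).
    have m1 : (fun t => a1 t * h.1) @ F --> l1 / toC delta * h.1 by exact: cvgC_mulr.
    have m2 : (fun t => a2 t * h.2) @ F --> l2 / toC delta * h.2 by exact: cvgC_mulr.
    rewrite /L /lin2; apply: (@cvgD _ _ _ _ _ (fA ^~ p)
      (fun t => a1 t * h.1 + a2 t * h.2)) fp _.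
    exact: (@cvgD _ _ _ _ _ (fun t => a1 t * h.1) (fun t => a2 t * h.2)) m1 m2.
  by near=> t; exact: rem.
have B0 : 0 <= B.
  have [t _] : exists t : T, True by apply: (@filter_ex _ F); exact: filterT.
  exact: jet_ge0 (jf t).
have Lcont : continuous (L : C * C -> C^o).
  move=> q; apply: cvgD; apply: cvgM; try exact: cvg_cst.
    exact: cvg_fst.
  exact: cvg_snd.
apply: (differentiable_remainder Lcont) => _ /posC_toC[e e0 ->]; near=> h.
  have [k hk k0] : exists2 k : R, `|h| = toC k & 0 <= k.
    exists (Num.max (cabs h.1) (cabs h.2)); last by rewrite le_max cabs_ge0.
    by rewrite prod_normE /= !normCE /Order.max toC_lt; case: ifP.
  have : `|h| <= toC k by rewrite hk.
  rewrite norm_pair_le => /andP[h1 h2].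
  have kr : k < Num.min delta (e * delta ^+ 2 / (B + 1)).
    rewrite -toC_lt -hk; near: h.
    apply: (@nbhs0_lt C (C * C)%type).
    by rewrite -[0]/(toC 0) toC_lt lt_min delta_gt0 divr_gt0 ?mulr_gt0
      ?exprn_gt0 ?ltr_wpDl.
  move: kr; rewrite lt_min => /andP[kd ke].
  have d0 : delta != 0 by rewrite gt_eqF.
  have := fL h (k / delta); rewrite divfK // => /(_ _ h1 h2).
  rewrite hk normCE -toCM toC_le [h + p]addrC => fLh.
  apply: le_trans (fLh _) _.
    by rewrite divr_ge0 ?(ltW delta_gt0) //= ler_pdivrMr // mul1r ltW.
  rewrite ltr_pdivlMr ?ltr_wpDl // in ke.
  rewrite expr_div_n mulrA ler_pdivrMr ?exprn_gt0 //.
  have : 0 <= k * (e * delta ^+ 2 - k * (B + 1)) by rewrite mulr_ge0 // subr_ge0 ltW.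
  by nra.
Unshelve. all: by end_near. Qed.

End Jets.

(** * The common powers of the two terms of a factor *)

Definition ipos (z : int) : nat := if z is Posz k then k else 0%N.
Definition ineg (z : int) : nat := if z is Negz k then k.+1 else 0%N.

Lemma iposBineg (z : int) : (ipos z)%:Z - (ineg z)%:Z = z.
Proof. by case: z => k /=; lia. Qed.

Section Estimates.
Variables (R : realType) (K : realQuadField R) (a : set K) (m : nat).
Variables alpha beta : K.
Hypotheses (a_ideal : frac_ideal a) (basis : zbasis (ideal_inv a) alpha beta).
Hypotheses (alpha_pos : totally_positive alpha).
Hypotheses (beta_pos : totally_positive beta).
Implicit Types l mu gam : K.
Local Notation Lam := (Lambda_plus a m).
Local Notation c := (@negnorm R K a m).
Local Notation T gam l := (trw l (emb gam, emb (qconj gam))).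

Lemma common_exponent_ipos mu l : Lam l -> ideal_inv a mu ->
  emb l * emb mu = common_exponent mu mu l + (ipos (trint mu l))%:R.
Proof.
move=> Ll amu; rewrite /common_exponent (trw_trint Ll amu) ler0z.
have := trw_trint Ll amu; rewrite /trw /=.
case: (trint mu l) => k /= E; last by rewrite addr0.
by rewrite mulNr -[k%:R]/(k%:~R : R) -E; ring.
Qed.

Lemma common_exponent_ineg mu l : Lam l -> ideal_inv a mu ->
  - emb (qconj l) * emb (qconj mu) = common_exponent mu mu l + (ineg (trint mu l))%:R.
Proof.
move=> Ll amu; have := common_exponent_ipos Ll amu.
have := trw_trint Ll amu; rewrite /trw /= -{1}[trint mu l]iposBineg intrB.
rewrite -![_%:~R]/(_%:R); move: (ipos _)%:R (ineg _)%:R => p q; lra.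
Qed.

Lemma weight_small (x D : R) : 0 < x -> x ^+ 2 <= D -> x <= 2 * (1 + D) * weight x.
Proof.
move=> x0 xD; have x1 : 0 < (1 + x) ^+ 2 by rewrite exprn_gt0 // addr_gt0.
rewrite /weight mulrA ler_pdivlMr // mulrC ler_pM2r //.
have := sqr_ge0 (x - 1); rewrite sqrrB sqrrD expr1n; lra.
Qed.

Lemma weight_big (x E : R) : 0 < x -> 1 <= E * x ^+ 2 -> x^-1 <= 2 * (1 + E) * weight x.
Proof.
move=> x0 xE; have x1 : 0 < (1 + x) ^+ 2 by rewrite exprn_gt0 // addr_gt0.
rewrite /weight mulrA ler_pdivlMr // -(ler_pM2l x0) mulVKf ?gt_eqF //.
have := sqr_ge0 (x - 1); rewrite sqrrB sqrrD expr1n; nra.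
Qed.

Lemma negnorm_gt0 l : Lam l -> 0 < c.
Proof. by move=> /LambdaP[x0 y0 <-]; rewrite mulr_gt0 // oppr_gt0. Qed.

Lemma common_exponent_bound gam mu : totally_positive gam ->
  exists M : R, forall l, Lam l -> `|common_exponent gam mu l| <= M * weight (emb l).
Proof.
move=> [g0 g0'].
have [Lam0|/set0P[l0 /negnorm_gt0 c0]] := eqVneq Lam set0.
  by exists 0; rewrite Lam0.
pose E := emb gam / (c * emb (qconj gam)).
pose D := c * emb (qconj gam) / emb gam.
exists (2 * (1 + D) * `|emb mu| + 2 * (1 + E) * (c * `|emb (qconj mu)|)) => l Ll.
have [x0 y0 xy] := LambdaP Ll.
have w0 := weight_ge0 x0.
have E0 : 0 <= E by rewrite divr_ge0 ?mulr_ge0 ?ltW.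
have D0 : 0 <= D by rewrite divr_ge0 ?mulr_ge0 ?ltW.
have cg0 : 0 < c * emb (qconj gam) by rewrite mulr_gt0.
rewrite /common_exponent; case: ifP => Tl.
  have xE : 1 <= E * emb l ^+ 2.
    rewrite /E mulrAC ler_pdivlMr // mul1r -xy.
    by move: Tl; rewrite /trw /=; nra.
  have yE : - emb (qconj l) = c / emb l by rewrite -xy mulrC mulKf // gt_eqF.
  rewrite yE !normrM (gtr0_norm c0) (@gtr0_norm _ (_^-1)) ?invr_gt0 //.
  rewrite mulrDl -[leLHS]add0r; apply: lerD.
    by apply: mulr_ge0 w0; apply: mulr_ge0 => //; rewrite mulr_ge0 // addr_ge0.
  rewrite [leRHS](_ : _ = 2 * (1 + E) * weight (emb l) * (c * `|emb (qconj mu)|)); last by ring.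
  rewrite [leLHS](_ : _ = (emb l)^-1 * (c * `|emb (qconj mu)|)); last by ring.
  by rewrite ler_wpM2r ?mulr_ge0 ?(ltW c0) // weight_big.
have xD : emb l ^+ 2 <= D.
  rewrite /D ler_pdivlMr // -xy.
  by move: Tl => /negbT; rewrite -ltNge /trw /=; nra.
rewrite normrM (gtr0_norm x0) mulrDl -[leLHS]addr0; apply: lerD; last first.
  by apply: mulr_ge0 w0; rewrite !mulr_ge0 ?addr_ge0 // ltW.
by rewrite mulrAC ler_wpM2r // weight_small.
Qed.

Lemma common_exponent_sum gam mu : totally_positive gam ->
  (fun A : {fset K} => \sum_(l <- A) (if l \in Lam then common_exponent gam mu l else 0))
    @ totally --> (emb (qtrace (weylK a m gam * mu)) : R).
Proof.
move=> gam_pos; have [M thetaM] := common_exponent_bound mu gam_pos.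
have [S _ Sle] := weight_bounded m a_ideal basis alpha_pos beta_pos.
apply: (@sum_cvg_exhaust _ _ (fun l => if l \in Lam then weight (emb l) else 0) S _ _ _ M
  _ (orbit_box a m gam)).
- by move=> l; case: ifP => // /set_mem /LambdaP[x0 _ _]; exact: weight_ge0.
- by move=> A; rewrite -big_mkcond.
- move=> l; case: ifP => [/set_mem /thetaM //|_]; by rewrite normr0 mulr0.
- by move=> N; exact: orbit_box_uniq basis alpha_pos beta_pos _ gam_pos _.
- move=> A; have [N0 N0P] : exists N0, forall N, (N0 <= N)%N ->
      {subset [seq l <- A | l \in Lam] <= orbit_box a m gam N}.
    apply: (orbit_box_cover a_ideal basis alpha_pos beta_pos gam_pos) => l.
    by rewrite mem_filter => /andP[/set_mem].
  exists N0 => N NN l lA; case: ifP => [lL _|_]; last by rewrite eqxx.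
  by apply: (N0P _ NN); rewrite mem_filter lL.
have -> : (fun N => \sum_(l <- orbit_box a m gam N)
      (if l \in Lam then common_exponent gam mu l else 0)) =
    fun N => (1 - (Eps2 K)^-1 ^+ N) * emb (qtrace (weylK a m gam * mu)).
  apply/funext => N; rewrite exprVn.
  rewrite -(sum_common_exponent_box m basis alpha_pos beta_pos _ _ gam_pos).
  rewrite big_seq [RHS]big_seq; apply: eq_bigr => l lN.
  have Ll : Lam l := orbit_box_Lambda a_ideal basis alpha_pos beta_pos gam_pos lN.
  by rewrite mem_set.
have : (1 - (Eps2 K)^-1 ^+ N) * emb (qtrace (weylK a m gam * mu)) @[N --> \oo] -->
    (1 - 0) * emb (qtrace (weylK a m gam * mu)).
  apply: cvgMr_tmp; apply: cvgB; first exact: cvg_cst.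
  apply: cvg_expr.
  by rewrite gtr0_norm ?invr_gt0 ?Eps2_gt0 // invf_lt1 ?Eps2_gt0 // Eps2_gt1.
by rewrite subr0 mul1r.
Qed.

End Estimates.

(** * The reduced product *)

Section ReducedProduct.
Variables (R : realType) (K : realQuadField R) (a : set K) (m : nat).
Variables (alpha beta : K) (sigma : K -> int).
Hypotheses (a_ideal : frac_ideal a) (basis : zbasis (ideal_inv a) alpha beta).
Hypotheses (alpha_pos : totally_positive alpha).
Hypotheses (beta_pos : totally_positive beta).
Hypothesis sigmaP : admissible_sign a m sigma.
Implicit Types l mu gam : K.
Local Notation C := (Cplx R).
Local Notation Lam := (Lambda_plus a m).
Local Notation c := (@negnorm R K a m).
Local Notation T gam l := (trw l (emb gam, emb (qconj gam))).
Local Notation A l := (trint alpha l).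
Local Notation B l := (trint beta l).

(** [N l] being fixed, for small [emb l] the conjugate dominates the trace, and
    for large [emb l] it is negligible. *)
Lemma trint_neg gam l : Lam l -> totally_positive gam -> ideal_inv a gam ->
  emb l <= 1 -> emb l < c * emb (qconj gam) / emb gam -> trint gam l < 0.
Proof.
move=> Ll [g0 g0'] agam l1; rewrite ltr_pdivlMr // => lg.
have [x0 y0 xy] := LambdaP Ll.
rewrite -(ltrz0 R) -(trw_trint Ll agam) /trw /=.
rewrite -(pmulr_rlt0 _ x0); move: lg; rewrite -xy.
have : 0 <= (1 - emb l) * (emb l * emb gam) by rewrite !mulr_ge0 ?subr_ge0 // ltW.
by nra.
Qed.

Lemma trint_pos gam l : Lam l -> totally_positive gam -> ideal_inv a gam ->
  1 <= emb l -> c * emb (qconj gam) / emb gam < emb l -> 0 < trint gam l.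
Proof.
move=> Ll [g0 g0'] agam l1; rewrite ltr_pdivrMr // => lg.
have [x0 y0 xy] := LambdaP Ll.
rewrite -(ltr0z R) -(trw_trint Ll agam) /trw /=.
rewrite -(pmulr_rgt0 _ x0); move: lg; rewrite -xy.
have : 0 <= (emb l - 1) * (emb l * emb gam) by rewrite !mulr_ge0 ?subr_ge0 // ltW.
by nra.
Qed.

(** Outside a compact interval of values of [emb l], the signs of the traces and
    the value of [sigma] make [red_factor l] of the form [1] minus a monomial in
    [u] and [v] with positive exponents. *)
Lemma separation : exists d M : R, [/\ 0 < d, 0 < M,
  forall l, Lam l -> emb l < d -> [/\ sigma l = 1, A l < 0 & B l < 0] &
  forall l, Lam l -> M < emb l -> [/\ sigma l = -1, 0 < A l & 0 < B l]].
Proof.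
have [Lam0|/set0P[l0 /negnorm_gt0 c0]] := eqVneq Lam set0.
  by exists 1, 1; split=> // l; rewrite Lam0.
have [_ [d0 d00 d0P] [M0 M0P]] := sigmaP.
have [aa ab _] := basis; have [p1 p2] := alpha_pos; have [q1 q2] := beta_pos.
pose da := c * emb (qconj alpha) / emb alpha.
pose db := c * emb (qconj beta) / emb beta.
exists (Num.min d0 (Num.min 1 (Num.min da db))).
exists (Num.max M0 (Num.max 1 (Num.max da db))); split.
- by rewrite !lt_min d00 ltr01 /da /db !divr_gt0 ?mulr_gt0.
- by rewrite !lt_max ltr01 orbT.
- move=> l Ll; rewrite !lt_min => /and4P[ld l1 la lb]; split; first exact: d0P.
    by apply: trint_neg => //; exact: ltW.
  by apply: trint_neg => //; exact: ltW.
- move=> l Ll; rewrite !gt_max => /and4P[ld l1 la lb]; split; first exact: M0P.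
    by apply: trint_pos => //; exact: ltW.
  by apply: trint_pos => //; exact: ltW.
Qed.

(** What is left of the factor of [l] once the common powers of [u] and [v] of
    its two terms are taken out. *)
Definition red_factor l (p : C * C) : C := if l \in Lam then
  (sigma l)%:~R * (p.1 ^+ ipos (A l) * p.2 ^+ ipos (B l)
                   - p.1 ^+ ineg (A l) * p.2 ^+ ineg (B l)) else 1.

Variables d M : R.
Hypotheses (d_gt0 : 0 < d) (M_gt0 : 0 < M).
Hypothesis small : forall l, Lam l -> emb l < d -> [/\ sigma l = 1, A l < 0 & B l < 0].
Hypothesis big : forall l, Lam l -> M < emb l -> [/\ sigma l = -1, 0 < A l & 0 < B l].

Definition mono_bound (x y : R) (i j : nat) : R := expR x ^+ i * expR y ^+ j.

Lemma mono_bound_ge0 x y i j : 0 <= mono_bound x y i j.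
Proof. by rewrite mulr_ge0 // exprn_ge0 // expR_ge0. Qed.

Lemma mono_boundE x y i j : mono_bound x y i j = expR (x * i%:R + y * j%:R).
Proof. by rewrite expRD !expRM_natr. Qed.

(** A bound for [red_factor l - 1] on a polydisc with radii [expR x], [expR y]. *)
Definition dev_bound (x y : R) l : R := if l \in Lam then
  if emb l < d then mono_bound x y (ineg (A l)) (ineg (B l))
  else if M < emb l then mono_bound x y (ipos (A l)) (ipos (B l))
  else 1 + mono_bound x y (ipos (A l)) (ipos (B l))
         + mono_bound x y (ineg (A l)) (ineg (B l)) else 0.

Lemma dev_bound_ge0 x y l : 0 <= dev_bound x y l.
Proof.
rewrite /dev_bound; case: ifP => // _; case: ifP => _; first exact: mono_bound_ge0.
case: ifP => _; first exact: mono_bound_ge0.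
by rewrite !addr_ge0 // mono_bound_ge0.
Qed.

Lemma ineg_small (z : int) : z < 0 -> (ineg z)%:R = - z%:~R :> R.
Proof. by case: z => // k _; rewrite NegzE mulrNz opprK. Qed.

Lemma ipos_small (z : int) : z < 0 -> ipos z = 0%N.
Proof. by case: z. Qed.

Lemma ipos_big (z : int) : 0 < z -> (ipos z)%:R = z%:~R :> R.
Proof. by case: z. Qed.

Lemma ineg_big (z : int) : 0 < z -> ineg z = 0%N.
Proof. by case: z. Qed.

(** The hypotheses on [x] and [y] make the monomial bounds decay like
    [exp (- k1 * emb l)] for large [emb l] and like [exp (- k2 * c / emb l)] for
    small [emb l], where [c] is the constant value of [- N l]; the remaining [l]
    are finite in number. *)
Lemma dev_bound_weight x y :
  emb alpha * x + emb beta * y < 0 ->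
  emb (qconj alpha) * x + emb (qconj beta) * y < 0 ->
  exists2 D, 0 <= D & forall l,
    dev_bound x y l <= D * (if l \in Lam then weight (emb l) else 0).
Proof.
set k1 := - (emb alpha * x + emb beta * y).
set k2 := - (emb (qconj alpha) * x + emb (qconj beta) * y).
rewrite -oppr_gt0 -/k1 -oppr_gt0 -/k2 => k10 k20.
have [Lam0|/set0P[l0 /negnorm_gt0 c0]] := eqVneq Lam set0.
  by exists 0 => // l; rewrite /dev_bound Lam0 in_set0 mulr0.
have [aa ab _] := basis.
have finS := Lambda_strip_finite m basis alpha_pos beta_pos M d_gt0.
set strip := [set l | _] in finS.
pose D3 := \sum_(l <- fset_set strip) dev_bound x y l / weight (emb l).
pose D1 := expR (k1 * d) / (k2 * c) * (2 * (1 + d ^+ 2)).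
pose D2 := expR (k2 * c / M) / k1 * (2 * (1 + M ^- 2)).
have kc0 : 0 < k2 * c by rewrite mulr_gt0.
have D10 : 0 <= D1.
  apply: mulr_ge0; first by rewrite divr_ge0 ?expR_ge0 // ltW.
  by rewrite mulr_ge0 // addr_ge0 // sqr_ge0.
have D20 : 0 <= D2.
  apply: mulr_ge0; first by rewrite divr_ge0 ?expR_ge0 // ltW.
  by rewrite mulr_ge0 // addr_ge0 // invr_ge0 sqr_ge0.
have w0 l : Lam l -> 0 < weight (emb l).
  by move=> /LambdaP[x0 _ _]; rewrite divr_gt0 // exprn_gt0 // addr_gt0.
have D3ge l : strip l -> dev_bound x y l <= D3 * weight (emb l).
  move=> Sl; have Ll : Lam l by case: Sl.
  rewrite -ler_pdivrMr ?w0 // /D3 (bigD1_seq l) ?fset_uniq //=; last first.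
    by rewrite in_fset_set //; exact: mem_set.
  rewrite lerDl big_seq_cond sumr_ge0 // => l' /andP[].
  rewrite in_fset_set // => /set_mem[Ll' _] _.
  by rewrite divr_ge0 ?dev_bound_ge0 // ltW // w0.
have D30 : 0 <= D3.
  rewrite /D3 big_seq sumr_ge0 // => l'.
  rewrite in_fset_set // => /set_mem[Ll' _].
  by rewrite divr_ge0 ?dev_bound_ge0 // ltW // w0.
exists (D1 + D2 + D3); first by rewrite !addr_ge0.
move=> l; have [/set_mem Ll|lL] := boolP (l \in Lam); last first.
  by rewrite /dev_bound (negPf lL) mulr0.
have [x0 y0 xy] := LambdaP Ll; have wl := ltW (w0 _ Ll).
have xA : x * (A l)%:~R + y * (B l)%:~R = - k1 * emb l + k2 * (c / emb l).
  have yE : c / emb l = - emb (qconj l) by rewrite -xy mulrC mulKf // gt_eqF.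
  rewrite -(trw_trint Ll aa) -(trw_trint Ll ab) /trw /= yE /k1 /k2; ring.
have expV (t : R) : 0 < t -> expR (- t) <= t^-1.
  move=> t0; rewrite expRN lef_pV2 ?posrE ?expR_gt0 //.
  by apply: le_trans (expR_ge1Dx t); rewrite lerDr.
have [ld|ld] := ltP (emb l) d.
  apply: (@le_trans _ _ (D1 * weight (emb l))); last first.
    by rewrite ler_wpM2r // -addrA lerDl addr_ge0.
  have [_ A0 B0] := small Ll ld.
  rewrite /dev_bound mem_set // ld mono_boundE !ineg_small //.
  have -> : x * - (A l)%:~R + y * - (B l)%:~R = k1 * emb l + - (k2 * (c / emb l)).
    by rewrite -[RHS]opprK opprD opprK -mulNr -xA; ring.
  rewrite expRD /D1 -mulrA -mulrA; apply: ler_pM; rewrite ?expR_ge0 //.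
    by rewrite ler_expR ler_pM2l // ltW.
  apply: le_trans (expV _ _) _; first by rewrite !mulr_gt0 ?invr_gt0.
  have -> : (k2 * (c / emb l))^-1 = (k2 * c)^-1 * emb l.
    by rewrite mulrA invf_div mulrC.
  rewrite ler_pM2l ?invr_gt0 //.
  by apply: weight_small => //; rewrite ler_pXn2r ?nnegrE ?ltW.
have [lM|lM] := ltP M (emb l).
  apply: (@le_trans _ _ (D2 * weight (emb l))); last first.
    by rewrite ler_wpM2r // addrAC lerDr addr_ge0.
  have [_ A0 B0] := big Ll lM.
  rewrite /dev_bound mem_set // ltNge ld lM /= mono_boundE !ipos_big // xA.
  rewrite addrC expRD /D2 -mulrA -mulrA; apply: ler_pM; rewrite ?expR_ge0 //.
    by rewrite ler_expR -mulrA ler_pM2l // ler_pM2l // lef_pV2 ?posrE // ltW.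
  rewrite mulNr; apply: le_trans (expV _ _) _; first by rewrite mulr_gt0.
  rewrite invfM ler_pM2l ?invr_gt0 //; apply: weight_big => //.
  rewrite mulrC ler_pdivlMr ?exprn_gt0 // mul1r.
  by rewrite ler_pXn2r ?nnegrE ?ltW.
apply: le_trans (D3ge l _) _; first by split=> //; rewrite ld.
by rewrite ler_wpM2r // lerDr addr_ge0.
Qed.

End ReducedProduct.

Section ReducedProductLimit.
Variables (R : realType) (K : realQuadField R) (a : set K) (m : nat).
Variables (alpha beta : K) (sigma : K -> int).
Hypotheses (a_ideal : frac_ideal a) (basis : zbasis (ideal_inv a) alpha beta).
Hypotheses (alpha_pos : totally_positive alpha).
Hypotheses (beta_pos : totally_positive beta).
Hypothesis sigmaP : admissible_sign a m sigma.
Implicit Types l mu gam : K.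
Local Notation C := (Cplx R).
Local Notation Lam := (Lambda_plus a m).
Local Notation A l := (trint alpha l).
Local Notation B l := (trint beta l).
Local Notation red_factor := (red_factor a m alpha beta sigma).

Section FixedBounds.
Variables d M : R.
Hypotheses (d_gt0 : 0 < d) (M_gt0 : 0 < M).
Hypothesis small : forall l, Lam l -> emb l < d -> [/\ sigma l = 1, A l < 0 & B l < 0].
Hypothesis big : forall l, Lam l -> M < emb l -> [/\ sigma l = -1, 0 < A l & 0 < B l].
Local Notation dev_bound := (dev_bound a m alpha beta d M).

Lemma red_factor_small l p : Lam l -> emb l < d ->
  red_factor l p = 1 + -1 * (p.1 ^+ ineg (A l) * p.2 ^+ ineg (B l)).
Proof.
move=> Ll ld; have [s1 A0 B0] := small Ll ld.
by rewrite /red_factor mem_set // s1 !ipos_small // !expr0 !mul1r mulN1r.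
Qed.

Lemma red_factor_big l p : Lam l -> M < emb l ->
  red_factor l p = 1 + -1 * (p.1 ^+ ipos (A l) * p.2 ^+ ipos (B l)).
Proof.
move=> Ll lM; have [s1 A0 B0] := big Ll lM.
rewrite /red_factor mem_set // s1 !ineg_big // !expr0 mulr1 mulrN1z !mulN1r.
by rewrite opprB.
Qed.

Lemma sigma_cabs l : Lam l -> cabs ((sigma l)%:~R : C) = 1.
Proof.
by case: sigmaP => + _ _ => /[apply] -[->|->]; rewrite ?mulrN1z ?cabsN ?mulr1z cabs1.
Qed.

Lemma monomial_jet (delta x y : R) (p : C * C) (i j : nat) : 0 < delta ->
  cabs p.1 + delta <= expR x -> cabs p.2 + delta <= expR y ->
  jet_at delta p (mono_bound x y i j) (fun q => q.1 ^+ i * q.2 ^+ j).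
Proof.
by move=> d0 px py; apply: jetM => //; apply: jetX => //; [exact: jet_fst|exact: jet_snd].
Qed.

(** The bound [1 + dev_bound] is what makes the product of the bounds over all
    finite sets bounded. *)
Lemma red_factor_jet (delta x y : R) (p : C * C) l : 0 < delta ->
  cabs p.1 + delta <= expR x -> cabs p.2 + delta <= expR y ->
  jet_at delta p (1 + dev_bound x y l) (red_factor l).
Proof.
move=> d0 px py; have mj i j := monomial_jet i j d0 px py.
have m1 : cabs (-1 : C) = 1 by rewrite cabsN cabs1.
have jet1 i j : jet_at delta p (1 + mono_bound x y i j)
    (fun q => 1 + -1 * (q.1 ^+ i * q.2 ^+ j)).
  apply: jetD => //; first by rewrite -(cabs1 R); exact: jet_cst.
  by rewrite -[mono_bound _ _ _ _]mul1r -m1; apply: jetM => //; exact: jet_cst.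
rewrite /dev_bound; have [/set_mem Ll|lL] := boolP (l \in Lam); last first.
  rewrite addr0 (_ : red_factor l = fun=> 1).
    by rewrite -(cabs1 R); exact: jet_cst.
  by apply/funext => q; rewrite /red_factor (negPf lL).
case: ifP => ld.
  rewrite (_ : red_factor l =
    fun q => 1 + -1 * (q.1 ^+ ineg (A l) * q.2 ^+ ineg (B l))) //.
  by apply/funext => q; exact: red_factor_small.
case: ifP => lM.
  rewrite (_ : red_factor l =
    fun q => 1 + -1 * (q.1 ^+ ipos (A l) * q.2 ^+ ipos (B l))) //.
  by apply/funext => q; exact: red_factor_big.
rewrite (_ : red_factor l = fun q => (sigma l)%:~R *
    (q.1 ^+ ipos (A l) * q.2 ^+ ipos (B l)
     + -1 * (q.1 ^+ ineg (A l) * q.2 ^+ ineg (B l)))); last first.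
  by apply/funext => q; rewrite /red_factor mem_set // mulN1r.
apply: (@jet_le _ _ _ (1 * (mono_bound x y (ipos (A l)) (ipos (B l)) +
   1 * mono_bound x y (ineg (A l)) (ineg (B l))))).
  have := mono_bound_ge0 x y (ipos (A l)) (ipos (B l)); lra.
apply: jetM => //; first by rewrite -(sigma_cabs Ll); exact: jet_cst.
apply: jetD => //; apply: jetM => //; rewrite -m1; exact: jet_cst.
Qed.

Lemma monomial_le (x y : R) (p : C * C) i j : cabs p.1 <= expR x ->
  cabs p.2 <= expR y -> cabs (p.1 ^+ i * p.2 ^+ j) <= mono_bound x y i j.
Proof.
move=> px py; rewrite cabsM !cabsX; apply: ler_pM; rewrite ?exprn_ge0 ?cabs_ge0 //.
  by rewrite lerXn2r ?nnegrE ?cabs_ge0 ?expR_ge0.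
by rewrite lerXn2r ?nnegrE ?cabs_ge0 ?expR_ge0.
Qed.

Lemma red_factor_near1 (x y : R) (p : C * C) l :
  cabs p.1 <= expR x -> cabs p.2 <= expR y ->
  cabs (red_factor l p - 1) <= dev_bound x y l.
Proof.
move=> px py; have ml i j := monomial_le i j px py.
have sub1 (z : C) : cabs (1 + -1 * z - 1) = cabs z.
  by rewrite addrAC subrr add0r mulN1r cabsN.
rewrite /dev_bound; have [/set_mem Ll|lL] := boolP (l \in Lam); last first.
  by rewrite /red_factor (negPf lL) subrr cabs0.
case: ifP => ld; first by rewrite red_factor_small // sub1.
case: ifP => lM; first by rewrite red_factor_big // sub1.
rewrite /red_factor mem_set //; apply: le_trans (cabsB _ _) _.
rewrite cabs1 addrC -addrA lerD2l cabsM sigma_cabs // mul1r.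
by apply: le_trans (cabsB _ _) _; exact: lerD.
Qed.

Lemma red_factor_axis l v : Lam l -> emb l < d \/ M < emb l ->
  red_factor l (0, v) = 1 /\ red_factor l (v, 0) = 1.
Proof.
move=> Ll [ld|lM].
  have [_ A0 B0] := small Ll ld; rewrite !red_factor_small //=.
  have pos z : z < 0 -> (0 < ineg z)%N by case: z.
  by rewrite !expr0n !gtn_eqF ?pos // !(mul0r, mulr0) addr0.
have [_ A0 B0] := big Ll lM; rewrite !red_factor_big //=.
have pos z : 0 < z -> (0 < ipos z)%N by case: z.
by rewrite !expr0n !gtn_eqF ?pos // !(mul0r, mulr0) addr0.
Qed.

End FixedBounds.

(** The Reinhardt domain of convergence; [expR x] and [expR y] are the radii of
    a polydisc that contains the point and on which the product converges. *)
Definition conv_dom (p : C * C) : Prop := exists x y : R,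
  [/\ cabs p.1 < expR x, cabs p.2 < expR y,
      emb alpha * x + emb beta * y < 0 &
      emb (qconj alpha) * x + emb (qconj beta) * y < 0].

Definition red_product (p : C * C) : C :=
  lim ((fun s : {fset K} => \prod_(l <- s) red_factor l p) @ totally).

Lemma dev_bound_summable d M x y : 0 < d -> 0 < M ->
  (forall l, Lam l -> emb l < d -> [/\ sigma l = 1, A l < 0 & B l < 0]) ->
  (forall l, Lam l -> M < emb l -> [/\ sigma l = -1, 0 < A l & 0 < B l]) ->
  emb alpha * x + emb beta * y < 0 ->
  emb (qconj alpha) * x + emb (qconj beta) * y < 0 ->
  exists S, forall s : {fset K}, \sum_(l <- s) dev_bound a m alpha beta d M x y l <= S.
Proof.
move=> d0 M0 small big xy xy'.
have [D D0 Dle] := dev_bound_weight basis alpha_pos beta_pos d0 M0 small big xy xy'.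
have [S _ Sle] := weight_bounded m a_ideal basis alpha_pos beta_pos.
exists (D * S) => s; apply: (@le_trans _ _ (D * \sum_(l <- s | l \in Lam) weight (emb l))).
  by rewrite [X in _ <= D * X]big_mkcond mulr_sumr; apply: ler_sum => l _; exact: Dle.
by rewrite ler_wpM2l.
Qed.

Lemma red_product_cvg p : conv_dom p ->
  (fun s : {fset K} => \prod_(l <- s) red_factor l p) @ totally --> red_product p.
Proof.
move=> [x [y [px py xy xy']]].
have [d [M [d0 M0 small big]]] := separation basis alpha_pos beta_pos sigmaP.
have [S Sle] := dev_bound_summable d0 M0 small big xy xy'.
have [q qP] := prod_cvg (dev_bound_ge0 a m alpha beta d M x y) Sle
  (fun l => red_factor_near1 small big l (ltW px) (ltW py)).
by rewrite /red_product (lim_cvgC qP).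
Qed.

Lemma prod1D_le_exp (I : Type) (h : I -> R) (s : seq I) : (forall i, 0 <= h i) ->
  \prod_(i <- s) (1 + h i) <= expR (\sum_(i <- s) h i).
Proof.
move=> h0; rewrite expR_sum; elim: s => [|i s IH]; first by rewrite !big_nil.
rewrite !big_cons; apply: ler_pM => //; first by rewrite addr_ge0.
  by rewrite prodr_ge0 // => j _; rewrite addr_ge0.
exact: expR_ge1Dx.
Qed.

Lemma red_product_differentiable p : conv_dom p -> differentiable red_product p.
Proof.
move=> [x [y [px py xy xy']]].
have [d [M [d0 M0 small big]]] := separation basis alpha_pos beta_pos sigmaP.
have [S Sle] := dev_bound_summable d0 M0 small big xy xy'.
pose delta := Num.min ((expR x - cabs p.1) / 2) ((expR y - cabs p.2) / 2).
have delta0 : 0 < delta by rewrite lt_min !divr_gt0 // subr_gt0.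
have dx : cabs p.1 + delta < expR x.
  have : delta <= (expR x - cabs p.1) / 2 by rewrite ge_min lexx.
  by lra.
have dy : cabs p.2 + delta < expR y.
  have : delta <= (expR y - cabs p.2) / 2 by rewrite ge_min lexx orbT.
  by lra.
apply: (@jet_limit_differentiable R delta p delta0 _ totally _
  (fun (s : {fset K}) q => \prod_(l <- s) red_factor l q) _ (expR S)) => [s|h h1 h2].
  apply: (@jet_le _ _ _ (\prod_(l <- s) (1 + dev_bound a m alpha beta d M x y l))).
    apply: le_trans (prod1D_le_exp _ (dev_bound_ge0 a m alpha beta d M x y)) _.
    by rewrite ler_expR.
  by apply: jet_prod => // l; apply: red_factor_jet => //; exact: ltW.
apply: red_product_cvg; exists x, y; split=> //.
  by apply: le_lt_trans (cabsD _ _) _; apply: le_lt_trans dx; rewrite lerD2l.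
by apply: le_lt_trans (cabsD _ _) _; apply: le_lt_trans dy; rewrite lerD2l.
Qed.

End ReducedProductLimit.

(** * The local Borcherds product in local coordinates *)

Section ChartAndPsi.
Variables (R : realType) (K : realQuadField R) (a : set K) (m : nat).
Variables (alpha beta : K) (sigma : K -> int).
Hypotheses (a_ideal : frac_ideal a) (basis : zbasis (ideal_inv a) alpha beta).
Hypotheses (alpha_pos : totally_positive alpha).
Hypotheses (beta_pos : totally_positive beta).
Hypothesis sigmaP : admissible_sign a m sigma.
Implicit Types l mu gam : K.
Local Notation C := (Cplx R).
Local Notation Lam := (Lambda_plus a m).
Local Notation A l := (trint alpha l).
Local Notation B l := (trint beta l).
Local Notation red_factor := (red_factor a m alpha beta sigma).
Local Notation red_product := (red_product a m alpha beta sigma).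
Local Notation conv_dom := (@conv_dom R K alpha beta).
Local Notation chart := (@local_chart R K alpha beta).
Local Notation coords := (@local_coords R K alpha beta).

(** The exponent is a sum over the representatives [r] of
    [n tr(r gam / (eps0 ^ 2 - 1))].  Each term is an integer since
    [n / (1 - eps0 ^ 2)] is integral, and is positive since both conjugates of
    [r gam / (eps0 ^ 2 - 1)] are: the conjugate of [r] is negative, and so is that of
    [eps0 ^ 2 - 1]. *)
Lemma weyl_order gam (n : nat) : totally_positive gam -> ideal_inv a gam ->
  (0 < n)%N -> ringInt (n%:R / (1 - eps0 ^+ 2) : K) ->
  exists2 k : nat, (k%:R : K) = n%:R * qtrace (weylK a m gam * gam) &
    (Lam !=set0 -> (0 < k)%N).
Proof.
move=> gam_pos agam n0 nP; have finR := Rset_finite m basis alpha_pos beta_pos gam_pos.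
set Rep := Rset a m _ in finR.
have Q1 := Eps2_gt1 K; have [g0 g0'] := gam_pos.
pose term r : K := n%:R * qtrace (r / (eps0 ^+ 2 - 1) * gam).
have termP r : Rep r -> exists2 k : nat, (0 < k)%N & term r = k%:R.
  move=> Rr; have Lr : Lam r by apply: Rset_Lambda Rr.
  have [x0 y0 _] := LambdaP Lr; have al : ideal_mul a (ideal_inv (@different R K)) r.
    by case: Lr.
  have [z zE] := trace_int al agam nP.
  have tE : term r = (- z)%:~R.
    rewrite mulrNz -zE -[1 - _]opprB invrN mulrN mulrN /qtrace rmorphN -opprD opprK.
    have -> : r * gam * (n%:R / (eps0 ^+ 2 - 1)) = n%:R * (r / (eps0 ^+ 2 - 1) * gam).
      by rewrite mulrCA mulrAC.
    by rewrite /term /qtrace mulrDr [X in _ = _ + X]rmorphM rmorph_nat.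
  have q1E : emb (eps0 ^+ 2 - 1 : K) = Eps2 K - 1 by rewrite rmorphB rmorph1.
  have q2E : emb (qconj (eps0 ^+ 2 - 1 : K)) = (Eps2 K)^-1 - 1.
    by rewrite rmorphB rmorph1 rmorphXn qconj_eps0_sqr rmorphB rmorph1 fmorphV.
  have : 0 < emb (term r).
    rewrite rmorphM rmorph_nat mulr_gt0 ?ltr0n // rmorphD /= addr_gt0 //.
      by rewrite rmorphM fmorph_div q1E mulr_gt0 ?divr_gt0 ?subr_gt0.
    rewrite [qconj _]rmorphM fmorph_div rmorphM fmorph_div q2E mulr_gt0 //.
    by rewrite nmulr_rgt0 // invr_lt0 subr_lt0 invf_lt1 // (lt_trans ltr01).
  rewrite tE rmorph_int ltr0z; case: (- z) => // k k0.
  by exists k.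
have sumP (s : seq K) : (forall r, r \in s -> Rep r) ->
    exists2 k : nat, \sum_(r <- s) term r = k%:R & (s != [::] -> (0 < k)%N).
  elim: s => [|r s IH] sR; first by exists 0%N; rewrite ?big_nil.
  have [|k kE k0] := IH; first by move=> r' r's; apply: sR; rewrite inE r's orbT.
  have [k' k'0 k'E] := termP r (sR r (mem_head _ _)).
  exists (k' + k)%N; first by rewrite big_cons k'E kE natrD.
  by rewrite addn_gt0 k'0.
have [|k kE k0] := sumP (fset_set Rep); first by move=> r; rewrite in_fset_set // => /set_mem.
exists k.
  rewrite -kE /weylK /weyl -/Rep fsbig_finite //= /qtrace mulr_suml.
  rewrite (raddf_sum (@qconj R K)) -big_split mulr_sumr; apply: eq_bigr => r _ //.
move=> [l Ll]; apply: k0.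
have [[i r] [/= Rr _]] := Rset_cover a_ideal gam_pos Ll.
have rR : r \in fset_set Rep by rewrite in_fset_set //; exact: mem_set.
by apply/eqP => E; have : r \in enum_fset (fset_set Rep) := rR; rewrite E.
Qed.

Lemma solve_small (p1 q1 p2 q2 y : R) : 0 < p1 -> 0 < p2 ->
  exists x, p1 * x + q1 * y < 0 /\ p2 * x + q2 * y < 0.
Proof.
move=> p10 p20; pose x1 := (- 1 - q1 * y) / p1; pose x2 := (- 1 - q2 * y) / p2.
have e1 : p1 * x1 = - 1 - q1 * y by rewrite mulrC divfK // gt_eqF.
have e2 : p2 * x2 = - 1 - q2 * y by rewrite mulrC divfK // gt_eqF.
exists (Num.min x1 x2); split.
  have : p1 * Num.min x1 x2 <= p1 * x1 by rewrite ler_pM2l // ge_min lexx.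
  by rewrite e1; lra.
have : p2 * Num.min x1 x2 <= p2 * x2 by rewrite ler_pM2l // ge_min lexx orbT.
by rewrite e2; lra.
Qed.

Lemma solve_shift (p1 q1 p2 q2 x y : R) : 0 < p1 -> 0 < q1 -> 0 < p2 -> 0 < q2 ->
  p1 * x + q1 * y < 0 -> p2 * x + q2 * y < 0 ->
  exists2 e, 0 < e & p1 * (x + e) + q1 * (y + e) < 0 /\ p2 * (x + e) + q2 * (y + e) < 0.
Proof.
move=> p10 q10 p20 q20 n1 n2.
pose e1 := - (p1 * x + q1 * y) / (2 * (p1 + q1)).
pose e2 := - (p2 * x + q2 * y) / (2 * (p2 + q2)).
have s10 : 0 < 2 * (p1 + q1) by rewrite mulr_gt0 // addr_gt0.
have s20 : 0 < 2 * (p2 + q2) by rewrite mulr_gt0 // addr_gt0.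
exists (Num.min e1 e2).
  by rewrite lt_min !divr_gt0 // oppr_gt0.
split.
  have : Num.min e1 e2 <= e1 by rewrite ge_min lexx.
  by rewrite ler_pdivlMr //; lra.
have : Num.min e1 e2 <= e2 by rewrite ge_min lexx orbT.
by rewrite ler_pdivlMr //; lra.
Qed.

Lemma lt_expR_ln (x : R) : 0 <= x -> x < expR (ln (x + 1)).
Proof. by move=> x0; rewrite lnK ?ltrDl // posrE ltr_wpDl. Qed.

(** On an axis one radius can be taken arbitrarily small.  Off the axes, the
    conditions [Im z1 > 0] and [Im z2 > 0] are the inequalities of [conv_dom] at
    the logarithms of the absolute values of [u] and [v], and they are open. *)
Lemma chart_conv_dom p : chart p -> conv_dom p.
Proof.
have [p1 p2] := alpha_pos; have [q1 q2] := beta_pos.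
case: p => u v [/= u0|/= v0|[z [z1 z2] [s [t [[-> ->] e1 e2]]]]].
- have [x [x1 x2]] := solve_small (emb beta) (emb (qconj beta)) (ln (cabs v + 1)) p1 p2.
  by exists x, (ln (cabs v + 1)); split; rewrite //= ?u0 ?cabs0 ?expR_gt0 // lt_expR_ln ?cabs_ge0.
- have [x [x1 x2]] := solve_small (emb alpha) (emb (qconj alpha)) (ln (cabs u + 1)) q1 q2.
  exists (ln (cabs u + 1)), x; split; rewrite /= ?v0 ?cabs0 ?expR_gt0 //.
  + by rewrite lt_expR_ln ?cabs_ge0.
  + by rewrite addrC.
  + by rewrite addrC.
- have re (x y : R) (w : C) : 0 < complex.Im w ->
      twopii R * w = toC x * s + toC y * t ->
      x * complex.Re s + y * complex.Re t < 0.
    case: w (s) (t) => w1 w2 [s1 s2] [t1 t2] /= w20 /(congr1 (@complex.Re R)) /=.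
    rewrite !mul0r !subr0 sub0r => <-.
    by rewrite oppr_lt0 !mulr_gt0 // pi_gt0.
  have re1 := re _ _ _ z1 e1; have re2 := re _ _ _ z2 e2.
  have [e e0 [n1 n2]] := solve_shift p1 q1 p2 q2 re1 re2.
  exists (complex.Re s + e), (complex.Re t + e); split=> //.
    by rewrite cabs_cexp ltr_expR ltrDl.
  by rewrite cabs_cexp ltr_expR ltrDl.
Qed.

Lemma cramer2 (F : fieldType) (p q p' q' w1 w2 : F) : p * q' - p' * q != 0 ->
  exists s t, w1 = p * s + q * t /\ w2 = p' * s + q' * t.
Proof.
move=> D0; exists ((q' * w1 - q * w2) / (p * q' - p' * q)).
exists ((p * w2 - p' * w1) / (p * q' - p' * q)).
by split; field.
Qed.

Lemma coords_exist z : exists p, coords z p.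
Proof.
have det : toC (emb alpha) * toC (emb (qconj beta)) -
    toC (emb (qconj alpha)) * toC (emb beta) != 0.
  rewrite -!toCM -toCN -toCD -cabs_eq0 cabs_toC normr_eq0 -!rmorphM -rmorphB.
  by rewrite emb_eq0 (basis_det basis).
have [s [t [e1 e2]]] := cramer2 (twopii R * z.1) (twopii R * z.2) det.
by exists (cexp s, cexp t), s, t.
Qed.

Lemma mulr_toC (f : {rmorphism K -> R}) (i j : int) mu : mu = alpha *~ i + beta *~ j ->
  toC (f mu) = toC (f alpha) * i%:~R + toC (f beta) * j%:~R.
Proof.
have tocz (x : R) (k : int) : toC (x *~ k) = toC x * k%:~R.
  by rewrite mulrzr; exact: (rmorphMz (real_complex R)).
by move=> ->; rewrite rmorphD !rmorphMz toCD !tocz.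
Qed.

(** In terms of the basis [mu = i alpha + j beta], the branches of [log u] and
    [log v] change by [2 pi i] times [i] and [j]. *)
Lemma coords_translate mu z p : ideal_inv a mu -> coords z p -> coords (translate mu z) p.
Proof.
move=> amu [s [t [-> e1 e2]]]; have [_ _ span] := basis.
have [[i j] [/= muE _]] := (span mu).1 amu.
exists (s + twopii R * i%:~R), (t + twopii R * j%:~R); split.
- by rewrite !cexpD !cexp_period !mulr1.
- by rewrite /= mulrDr e1 (mulr_toC emb muE); ring.
- by have /= -> := mulr_toC (emb \o qconj) muE; rewrite mulrDr e2; ring.
Qed.

Lemma cexp_toC_nat (x : R) (k : nat) (s : C) :
  cexp (toC (x + k%:R) * s) = cexp (toC x * s) * cexp s ^+ k.
Proof.
rewrite toCD mulrDl cexpD -cexpMn; congr (_ * cexp _).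
by rewrite [toC _](rmorph_nat (real_complex R)) mulr_natl.
Qed.

Lemma Psi_factor_coords z s t l : Lam l ->
  twopii R * z.1 = toC (emb alpha) * s + toC (emb beta) * t ->
  twopii R * z.2 = toC (emb (qconj alpha)) * s + toC (emb (qconj beta)) * t ->
  Psi_factor sigma l z =
    cexp (toC (common_exponent alpha alpha l) * s + toC (common_exponent beta beta l) * t) *
    red_factor l (cexp s, cexp t).
Proof.
move=> Ll e1 e2; have [x0 y0 _] := LambdaP Ll; have [aa ab _] := basis.
have term (w x y : C) (X p q : R) : twopii R * w = toC p * s + toC q * t ->
    e2pi (toC X * w) = cexp (toC (X * p) * s) * cexp (toC (X * q) * t).
  by move=> E; rewrite /e2pi mulrCA E mulrDr !mulrA -!toCM cexpD.
rewrite /Psi_factor (gtr0_norm x0) (ltr0_norm y0) (term _ 0 0 _ _ _ e1).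
rewrite (term _ 0 0 _ _ _ e2) /red_factor mem_set //=.
rewrite (common_exponent_ipos Ll aa) (common_exponent_ipos Ll ab).
rewrite (common_exponent_ineg Ll aa) (common_exponent_ineg Ll ab).
rewrite !cexp_toC_nat cexpD [RHS]mulrCA; congr (_ * _).
by rewrite mulrBr; congr (_ - _); rewrite mulrACA.
Qed.

Lemma Psi_coords z s t : conv_dom (cexp s, cexp t) ->
  twopii R * z.1 = toC (emb alpha) * s + toC (emb beta) * t ->
  twopii R * z.2 = toC (emb (qconj alpha)) * s + toC (emb (qconj beta)) * t ->
  Psi sigma a m z =
    cexp (toC (emb (qtrace (weylK a m alpha * alpha))) * s +
          toC (emb (qtrace (weylK a m beta * beta))) * t) *
    red_product (cexp s, cexp t).
Proof.
move=> dom e1 e2; rewrite /Psi.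
rewrite (_ : (fun s => _) = fun (S : {fset K}) =>
    cexp (toC (\sum_(l <- S) (if l \in Lam then common_exponent alpha alpha l else 0)) * s +
          toC (\sum_(l <- S) (if l \in Lam then common_exponent beta beta l else 0)) * t) *
    \prod_(l <- S) red_factor l (cexp s, cexp t)).
  apply: lim_cvgC; apply: cvgM.
    apply: cexp_cvg; first by
      exact: common_exponent_sum a_ideal basis alpha_pos beta_pos _ _ alpha_pos.
    exact: common_exponent_sum a_ideal basis alpha_pos beta_pos _ _ beta_pos.
  exact: red_product_cvg.
apply/funext => S; rewrite big_mkcond /=.
have toC_sum (f : K -> R) : toC (\sum_(l <- S) f l) = \sum_(l <- S) toC (f l).
  exact: (raddf_sum (real_complex R)).
rewrite !toC_sum !mulr_suml -big_split cexp_sum -big_split; apply: eq_bigr => l _ /=.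
case: ifP => [/set_mem Ll|lL]; first exact: Psi_factor_coords.
by rewrite /red_factor lL !mul0r addr0 cexp0 mulr1.
Qed.

(** If all factors beyond a finite set are [1], the limit is a finite product. *)
Lemma red_product_neq0 d M p : 0 < d -> conv_dom p ->
  (forall l, Lam l -> emb l < d \/ M < emb l -> red_factor l p = 1) ->
  (forall l, Lam l -> red_factor l p != 0) -> red_product p != 0.
Proof.
move=> d0 pdom one nz.
have finS := Lambda_strip_finite m basis alpha_pos beta_pos M d0.
set strip := [set l | _] in finS.
have inS l : (l \in fset_set strip) = (l \in strip) by rewrite in_fset_set.
rewrite /red_product (lim_cvgC (l := \prod_(l <- fset_set strip) red_factor l p)).
  rewrite big_seq prodf_seq_neq0; apply/allP => l _; apply/implyP.
  by rewrite inS => /set_mem[/nz].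
apply/cvgC_cabs => e e0; apply: filterS (near_totally (fset_set strip)) => S sS.
rewrite (big_fset_sub _ _ sS) /= [X in _ * X]big1_seq ?mulr1 ?subrr ?cabs0 //.
move=> l /andP[lS _]; have [/set_mem Ll|lL] := boolP (l \in Lam); last first.
  by rewrite /red_factor (negPf lL).
apply: one => //; have [|dl] := ltP (emb l) d; [by left|right].
rewrite ltNge; apply/negP => lM; move: lS; rewrite inS => /negP; apply.
by apply: mem_set; split=> //; rewrite dl.
Qed.

(** On the axis [u = 0] the two terms of [red_factor l] cannot cancel: if the trace
    [A] is not zero then exactly one of them vanishes, and if [A = 0] they are powers
    of [v] whose exponents differ by [B], which is not zero by [trace_inj]. *)
Lemma red_product_axis_neq0 (v := toC (1 / 2) : C) :
  red_product (0, v) != 0 /\ red_product (v, 0) != 0.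
Proof.
have [d [M [d0 M0 small big]]] := separation basis alpha_pos beta_pos sigmaP.
have [aa ab _] := basis.
have v0 : v != 0 by rewrite -cabs_eq0 cabs_toC normr_eq0 gt_eqF // divr_gt0.
have vinj (z : int) : v ^+ ipos z - v ^+ ineg z == 0 -> z = 0.
  rewrite subr_eq0 => /eqP/(congr1 (@cabs R)).
  rewrite !cabsX cabs_toC gtr0_norm ?divr_gt0 // => E.
  rewrite -[z]iposBineg; apply/eqP; rewrite subr_eq0; apply/eqP; congr Posz.
  by apply: ieexprIn E; rewrite ?divr_gt0 // lt_eqF // ltr_pdivrMr // mul1r ltr1n.
have AB l : Lam l -> A l = 0 -> B l = 0 -> False.
  move=> Ll A0 B0; have [x0 _ _] := LambdaP Ll.
  have l0 : l = 0.
    by apply: (trace_inj basis); rewrite (qtrace_trint Ll) ?A0 ?B0.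
  by move: x0; rewrite l0 rmorph0 ltxx.
have vn0 k : v ^+ k != 0 by rewrite expf_neq0.
have sig0 l : Lam l -> (sigma l)%:~R != 0 :> C.
  by move=> Ll; rewrite -cabs_eq0 (sigma_cabs sigmaP Ll) oner_eq0.
split; apply: (red_product_neq0 d0 (M := M)).
- by apply: chart_conv_dom; apply: Or31.
- by move=> l Ll /(red_factor_axis small big v Ll)[].
- move=> l Ll; rewrite /red_factor mem_set // mulf_neq0 ?sig0 //=.
  have := AB l Ll; case: (A l) => [[|k]|k] /= ABl.
  + rewrite !expr0 !mul1r; apply/negP => /vinj B0; exact: ABl.
  + by rewrite expr0n mul0r sub0r expr0 mul1r oppr_eq0.
  + by rewrite expr0 mul1r expr0n mul0r subr0.
- by apply: chart_conv_dom; apply: Or32.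
- by move=> l Ll /(red_factor_axis small big v Ll)[].
- move=> l Ll; rewrite /red_factor mem_set // mulf_neq0 ?sig0 //=.
  have := AB l Ll; case: (B l) => [[|k]|k] /= ABl.
  + rewrite !expr0 !mulr1; apply/negP => /vinj A0; exact: ABl.
  + by rewrite expr0n mulr0 sub0r expr0 mulr1 oppr_eq0.
  + by rewrite expr0 mulr1 expr0n mulr0 subr0.
Qed.

End ChartAndPsi.

Lemma differentiable_mul (R : realType) (f g : Cplx R * Cplx R -> Cplx R) p :
  differentiable f p -> differentiable g p -> differentiable (fun q => f q * g q) p.
Proof. exact: differentiableM. Qed.

Lemma differentiable_pow (R : realType) (f : Cplx R * Cplx R -> Cplx R) n p :
  differentiable f p -> differentiable (fun q => f q ^+ n) p.
Proof.
move=> fp; elim: n => [|n IH].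
  by rewrite (_ : (fun q => _) = cst 1) //; apply/funext => q; rewrite expr0.
rewrite (_ : (fun q => _) = fun q => f q * f q ^+ n); first exact: differentiable_mul.
by apply/funext => q; rewrite exprS.
Qed.

Lemma differentiable_fst_snd (R : realType) (p : Cplx R * Cplx R) :
  differentiable (fst : Cplx R * Cplx R -> Cplx R) p /\
  differentiable (snd : Cplx R * Cplx R -> Cplx R) p.
Proof.
split.
  apply: (@jet_limit_differentiable R 1 p ltr01 {fset nat} totally _ (fun=> fst) _ (cabs p.1 + 1)).
    by move=> _; apply: jet_fst.
  by move=> h _ _; exact: cvg_cst.
apply: (@jet_limit_differentiable R 1 p ltr01 {fset nat} totally _ (fun=> snd) _ (cabs p.2 + 1)).
  by move=> _; apply: jet_snd.
by move=> h _ _; exact: cvg_cst.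
Qed.

Theorem proposition3p20 (R : realType) (K : realQuadField R) (a : set K)
    (m n : nat) (alpha beta : K) (sigma : K -> int)
    (a_ideal : frac_ideal a) (m_gt0 : (0 < m)%N) (n_gt0 : (0 < n)%N)
    (sigmaP : admissible_sign a m sigma)
    (basis : zbasis (ideal_inv a) alpha beta)
    (alpha_pos : totally_positive alpha) (beta_pos : totally_positive beta)
    (nP : ringInt (n%:R / (1 - eps0 ^+ 2) : K)) :
  (forall mu z, ideal_inv a mu -> upper2 z ->
     Psi sigma a m (translate mu z) ^+ n = Psi sigma a m z ^+ n) /\
  exists F : Cplx R * Cplx R -> Cplx R,
    [/\ holomorphic_on (local_chart alpha beta) F,
        forall z p, upper2 z -> local_coords alpha beta z p ->
          F p = Psi sigma a m z ^+ n,
        Lambda_plus a m !=set0 ->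
          (forall v, F (0, v) = 0) /\ (forall u, F (u, 0) = 0),
        exists2 k : nat,
          (k%:R : K) = n%:R * qtrace (weylK a m alpha * alpha) &
          vanishing_order (local_chart alpha beta) fst F k &
        exists2 k : nat,
          (k%:R : K) = n%:R * qtrace (weylK a m beta * beta) &
          vanishing_order (local_chart alpha beta) snd F k].
Proof.
have [aa ab _] := basis.
have [k kE k0] := weyl_order m a_ideal basis alpha_pos beta_pos alpha_pos aa n_gt0 nP.
have [j jE j0] := weyl_order m a_ideal basis alpha_pos beta_pos beta_pos ab n_gt0 nP.
pose G := red_product a m alpha beta sigma.
pose F p := p.1 ^+ k * (p.2 ^+ j * G p ^+ n).
have Gdiff p : local_chart alpha beta p -> differentiable (fun q => G q ^+ n) p.
  move=> /(chart_conv_dom alpha_pos beta_pos) pdom; apply: differentiable_pow.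
  exact: red_product_differentiable pdom.
have udiff i p : differentiable (fun q : Cplx R * Cplx R => q.1 ^+ i) p.
  by apply: (@differentiable_pow R fst); case: (differentiable_fst_snd p).
have vdiff i p : differentiable (fun q : Cplx R * Cplx R => q.2 ^+ i) p.
  by apply: (@differentiable_pow R snd); case: (differentiable_fst_snd p).
have FPsi z p : upper2 z -> local_coords alpha beta z p -> F p = Psi sigma a m z ^+ n.
  move=> z0 zp; have pdom : conv_dom alpha beta p.
    by apply: chart_conv_dom => //; apply: Or33; exists z.
  move: zp pdom => [s [t [-> e1 e2]]] pdom.
  rewrite (Psi_coords a_ideal basis alpha_pos beta_pos sigmaP pdom e1 e2).
  rewrite exprMn -cexpMn mulrnDl cexpD /F /= -mulrA.
  have natE (i : nat) (gam : K) w : i%:R = n%:R * qtrace (weylK a m gam * gam) ->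
      cexp (toC (emb (qtrace (weylK a m gam * gam))) * w *+ n) = cexp w ^+ i.
    move=> iE; rewrite -cexpMn -mulr_natl -[w *+ i]mulr_natl; congr cexp.
    have nE : n%:R = toC (emb (n%:R : K)) :> Cplx R.
      by rewrite rmorph_nat [RHS](rmorph_nat (real_complex R)).
    rewrite mulrA nE -toCM -rmorphM -iE rmorph_nat.
    by rewrite [toC _](rmorph_nat (real_complex R)) mulr_natl.
  by rewrite (natE _ _ _ kE) (natE _ _ _ jE).
have [nz1 nz2] := red_product_axis_neq0 basis alpha_pos beta_pos sigmaP.
split.
  move=> mu z amu z0; have [p zp] := coords_exist basis z.
  have z0' : upper2 (translate mu z).
    have im (w : Cplx R) x : complex.Im (w + toC x) = complex.Im w.
      by case: w => w1 w2 /=; rewrite addr0.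
    by case: z0 => z1 z2; split; rewrite /= im.
  rewrite -(FPsi _ _ z0 zp) -(FPsi _ _ z0' (coords_translate basis amu zp)) //.
have half0 : toC (1 / 2) != 0 :> Cplx R.
  by rewrite -cabs_eq0 cabs_toC normr_eq0 gt_eqF // divr_gt0.
exists F; split=> //.
- move=> p Up; apply: differentiable_mul; first exact: udiff.
  by apply: differentiable_mul; [exact: vdiff|exact: Gdiff].
- move=> L0; split=> w; rewrite /F /= expr0n.
    by rewrite gtn_eqF ?k0 // mul0r.
  by rewrite gtn_eqF ?j0 // mul0r mulr0.
- exists k => //; exists (fun p => p.2 ^+ j * G p ^+ n); split=> //.
    by move=> p Up; apply: differentiable_mul; [exact: vdiff|exact: Gdiff].
  exists (0, toC (1 / 2)); split; [exact: Or31|by []|].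
  by apply: mulf_neq0; apply: expf_neq0; [exact: half0|exact: nz1].
- exists j => //; exists (fun p => p.1 ^+ k * G p ^+ n); split=> //.
  + by move=> p Up; apply: differentiable_mul; [exact: udiff|exact: Gdiff].
  + by move=> p Up; rewrite /F mulrCA.
  + exists (toC (1 / 2), 0); split; [exact: Or32|by []|].
    by apply: mulf_neq0; apply: expf_neq0; [exact: half0|exact: nz2].
Qed.
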